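(* Let $(\mathcal{A},\tau)$ be a non-commutative probability space with a tracial weight $\omega$, with domain $\operatorname{D}(\omega)\subset\mathcal{A}$. Consider $a\in\operatorname{D}(\omega)$ and $b_1,\ldots,b_k,c_1,\ldots,c_k\in\mathcal{A}$ such that $a$ is trace class with respect to $\omega$ and the pair $(\{a\},\{b_1,c_1,\ldots,b_k,c_k\})$ is cyclically monotone with respect to $(\omega,\tau)$. Assume that $a,b_1,c_1,\ldots,b_k,c_k$ are selfadjoint, and that $\sum_{i=1}^k b_iac_i$ is trace class with respect to $\omega$, so that its eigenvalues are defined. Let $B'=(\tau(c_ib_j))_{i,j=1}^k\in M_k(\mathbb{C})$. If $\lambda_1,\ldots,\lambda_k$ are the $k$ eigenvalues of $B'$ counting multiplicity, then $$\operatorname{EV}\left(\sum_{i=1}^k b_iac_i\right)=\bigsqcup_{i=1}^k\operatorname{EV}(\lambda_ia).$$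
   Context: A non-commutative probability space is a pair $(\mathcal{A},\tau)$ with $\mathcal{A}$ a unital $*$-algebra over $\mathbb{C}$ and $\tau:\mathcal{A}\to\mathbb{C}$ linear with $\tau(1_{\mathcal{A}})=1$; throughout $\tau$ is tracial: $\tau(xy)=\tau(yx)$. A tracial weight on $\mathcal{A}$ is a linear functional $\omega:\operatorname{D}(\omega)\to\mathbb{C}$ on a $*$-subalgebra $\operatorname{D}(\omega)\subset\mathcal{A}$ with $\omega(xy)=\omega(yx)$, $\omega(x^* )=\overline{\omega(x)}$ and $\omega(x^*x)\ge 0$ for all $x,y\in\operatorname{D}(\omega)$. An element $a\in\operatorname{D}(\omega)$ is trace class with respect to $\omega$ if there are a separable Hilbert space $H$ and a trace class operator $x$ on $H$ with the same distribution, i.e. $\omega(a^{\epsilon_1}\cdots a^{\epsilon_m})=\operatorname{Tr}_H(x^{\epsilon_1}\cdots x^{\epsilon_m})$ for all $m\ge1$ and all $\epsilon_j\in\{1,*\}$. In that case $\operatorname{EV}(a)$ is the multiset of eigenvalues (counted with algebraic multiplicity) of any such $x$. The multiplicity of the eigenvalue $0$ is not determined by the distribution, so equalities of such multisets are understood up to the multiplicity of $0$. The symbol $\sqcup$ denotes union of multisets with multiplicities added. Cyclic monotonicity: let $\mathcal{S},\mathcal{B}\subset\mathcal{A}$ be $*$-subalgebras with $1_{\mathcal{A}}\in\mathcal{B}$, and let $\operatorname{I}_{\mathcal{B}}(\mathcal{S})=\operatorname{span}\{b_0s_1b_1\cdots s_mb_m: m\ge1,\ s_i\in\mathcal{S},\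 b_i\in\mathcal{B}\}$. The pair $(\mathcal{S},\mathcal{B})$ is cyclically monotone with respect to $(\omega,\tau)$ if $\operatorname{I}_{\mathcal{B}}(\mathcal{S})\subset\operatorname{D}(\omega)$ and $\omega(s_1b_1\cdots s_mb_m)=\omega(s_1\cdots s_m)\tau(b_1)\cdots\tau(b_m)$ for all $m\ge1$, $s_i\in\mathcal{S}$, $b_i\in\mathcal{B}$. A pair of sets $(X,Y)$ with $X\subset\operatorname{D}(\omega)$, $Y\subset\mathcal{A}$ is cyclically monotone if $(\operatorname{alg}(X),\operatorname{alg}(\{1_{\mathcal{A}}\}\cup Y))$ is, where $\operatorname{alg}$ denotes the generated $*$-subalgebra (the unit is not adjoined to $\operatorname{alg}(X)$). *)

(* Defs.v *)
From HB Require Import structures.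
From mathcomp Require Import all_boot all_order all_algebra.
From mathcomp Require Export complex.
From mathcomp Require Export all_classical all_reals all_analysis.
Export numFieldNormedType.Exports.

Set Implicit Arguments.
Unset Strict Implicit.
Unset Printing Implicit Defensive.

Import Order.TTheory GRing.Theory Num.Theory.
Local Open Scope classical_set_scope.
Local Open Scope ring_scope.
Local Open Scope complex_scope.

(* Unital *-algebras over the complex numbers R[i]. *)

HB.mixin Record isStarAlgebra (R : realType) A of GRing.Algebra R[i] A := {
  star : A -> A;
  starD : {morph star : x y / x + y};
  starZ : forall (z : R[i]) (x : A), star (z *: x) = Num.conj z *: star x;
  starM : forall x y : A, star (x * y) = star y * star x;
  starK : involutive star
}.

#[short(type="starAlgType")]
HB.structure Definition StarAlgebra (R : realType) :=
  {A of isStarAlgebra R A & GRing.Algebra R[i] A}.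

Section NonCommutativeProbability.
Variables (R : realType) (A : starAlgType R).
Local Notation C := R[i].

Definition selfadjoint (x : A) : Prop := star x = x.

Record tracial_state (tau : {scalar A}) : Prop := {
  tracial_state1 : tau 1 = 1;
  tracial_stateC : forall x y, tau (x * y) = tau (y * x)
}.

Record linear_subspace (S : set A) : Prop := {
  linear_subspace0 : S 0;
  linear_subspaceD : forall x y, S x -> S y -> S (x + y);
  linear_subspaceZ : forall (z : C) x, S x -> S (z *: x)
}.

(* Not required to contain the unit. *)
Record star_subalgebra (S : set A) : Prop := {
  star_subalgebra_linear : linear_subspace S;
  star_subalgebraM : forall x y, S x -> S y -> S (x * y);
  star_subalgebra_star : forall x, S x -> S (star x)
}.

(* [weight] is a total function, meaningful only on [weight_dom]; every axiom
   below, and every later use, evaluates it inside the domain. *)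
Record tracial_weight := {
  weight_dom : set A;
  weight :> A -> C;
  weight_dom_alg : star_subalgebra weight_dom;
  weightD : forall x y, weight_dom x -> weight_dom y ->
    weight (x + y) = weight x + weight y;
  weightZ : forall (z : C) x, weight_dom x -> weight (z *: x) = z * weight x;
  weightC : forall x y, weight_dom x -> weight_dom y ->
    weight (x * y) = weight (y * x);
  weight_star : forall x, weight_dom x -> weight (star x) = Num.conj (weight x);
  weight_ge0 : forall x, weight_dom x -> 0 <= weight (star x * x)
}.

Definition star_alg (X : set A) : set A := smallest star_subalgebra X.

Definition lin_span (X : set A) : set A := smallest linear_subspace X.

Definition ideal_span (B S : set A) : set A :=
  lin_span [set x | exists (m : nat) (b0 : A) (s b : 'I_m.+1 -> A),
    [/\ B b0, forall i, S (s i), forall i, B (b i)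
      & x = b0 * \prod_(i < m.+1) (s i * b i)]].

Definition cyclically_monotone_alg (w : tracial_weight) (tau : {scalar A})
    (S B : set A) : Prop :=
  ideal_span B S `<=` weight_dom w /\
  forall (m : nat) (s b : 'I_m.+1 -> A),
    (forall i, S (s i)) -> (forall i, B (b i)) ->
    w (\prod_(i < m.+1) (s i * b i)) =
      w (\prod_(i < m.+1) s i) * \prod_(i < m.+1) tau (b i).

Definition cyclically_monotone (w : tracial_weight) (tau : {scalar A})
    (X Y : set A) : Prop :=
  cyclically_monotone_alg w tau (star_alg X) (star_alg ([set 1] `|` Y)).

End NonCommutativeProbability.

(* The inner product is linear in its first argument. *)
Record hilbertType (R : realType) := Hilbert {
  hilbert_car :> completeNormedModType R[i];
  hdot : {dot hilbert_car for Num.conj};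
  hdot_norm : forall u, hdot u u = `|u| ^+ 2
}.

Section Operators.
Variables (R : realType) (H : hilbertType R).
Local Notation C := R[i].
Local Notation "'[ u , v ]" := (hdot H u v).

Definition separable : Prop :=
  exists S : set H, countable S /\ dense S.

(* A Hilbert basis, padded with zero vectors so that finite-dimensional spaces
   are covered by the same indexing. *)
Definition hilbert_basis (e : nat -> H) : Prop :=
  [/\ forall n, e n = 0 \/ '[e n, e n] = 1,
      forall n m, n != m -> '[e n, e m] = 0
    & forall u, (forall n, '[u, e n] = 0) -> u = 0].

Definition has_trace (f : H -> H) (t : C) : Prop :=
  forall e, hilbert_basis e ->
    (series (fun n => '[f (e n), e n]) : nat -> C^o) @ \oo --> (t : C^o).

Definition adjoint (x y : H -> H) : Prop :=
  forall u v, '[x u, v] = '[u, y v].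

Definition positive (p : H -> H) : Prop := forall u, 0 <= '[p u, u].

(* [p] is the absolute value of the bounded operator [x], the positive square
   root of [x^* x]. *)
Definition abs_op (x p : {linear H -> H}) : Prop :=
  [/\ continuous p, positive p &
    exists2 y : {linear H -> H}, adjoint x y & p \o p =1 y \o x].

Definition trace_class (x : {linear H -> H}) : Prop :=
  continuous x /\
  exists2 p : {linear H -> H}, abs_op x p & exists t, has_trace p t.

Definition gen_eigenspace (x : H -> H) (z : C) : set H :=
  [set u | exists n : nat, iter n (fun v => x v - z *: v) u = 0].

Definition has_dim (S : set H) (n : nat) : Prop :=
  exists e : 'I_n -> H,
    [/\ forall i, S (e i),
        forall c : 'I_n -> C, \sum_i c i *: e i = 0 -> forall i, c i = 0
      & forall u, S u -> exists c : 'I_n -> C, u = \sum_i c i *: e i].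

Definition alg_mult (x : H -> H) (z : C) (n : nat) : Prop :=
  has_dim (gen_eigenspace x z) n.

End Operators.

(* A multiset of complex numbers is given by its multiplicity function. *)
Definition multiset (R : realType) := R[i] -> nat.

Definition eq_multiset0 (R : realType) (m1 m2 : multiset R) : Prop :=
  forall z, z != 0 -> m1 z = m2 z.

Definition big_munion (R : realType) (k : nat) (m : 'I_k -> multiset R) :
    multiset R :=
  fun z => (\sum_(i < k) m i z)%N.

Section Eigenvalues.
Variables (R : realType) (A : starAlgType R) (w : tracial_weight A).

(* [x] has the same distribution as [a]; [eps j = true] stands for the
   exponent [*]. *)
Definition same_distr (a : A) (H : hilbertType R) (x : {linear H -> H}) : Prop :=
  exists2 y : {linear H -> H}, adjoint x y &
  forall (m : nat) (eps : 'I_m.+1 -> bool),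
    has_trace
      (\big[(fun f g : H -> H => f \o g)/id]_(j < m.+1)
         (if eps j then y : H -> H else x))
      (w (\prod_(j < m.+1) (if eps j then star a else a))).

Definition realizes (a : A) (H : hilbertType R) (x : {linear H -> H}) : Prop :=
  [/\ separable H, trace_class x & same_distr a x].

Definition trace_class_elt (a : A) : Prop :=
  weight_dom w a /\
  exists (H : hilbertType R) (x : {linear H -> H}), realizes a x.

(* [m] lists, away from 0, the eigenvalues with algebraic multiplicity of any
   operator realizing [a]. *)
Definition is_EV (a : A) (m : multiset R) : Prop :=
  trace_class_elt a /\
  forall (H : hilbertType R) (x : {linear H -> H}), realizes a x ->
  forall z, z != 0 -> alg_mult x z (m z).

(* By definite description: [is_EV a] determines the multiset away from 0.  The
   value at 0 is arbitrary, so such multisets are compared by [eq_multiset0]. *)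
Definition EV (a : A) : multiset R := xget (fun=> 0%N) [set m | is_EV a m].

End Eigenvalues.

(* Main.v *)
From HB Require Import structures.
Require Import Defs.
From mathcomp Require Import all_boot all_order all_algebra.
From mathcomp Require Import complex all_classical all_reals all_analysis.
From mathcomp Require Import mxred spectral ring lra zify.

Import Order.TTheory GRing.Theory Num.Theory.
Import ComplexField.Normc.
Local Open Scope classical_set_scope.
Local Open Scope ring_scope.
Local Open Scope complex_scope.

Set Implicit Arguments.
Unset Strict Implicit.
Unset Printing Implicit Defensive.

Local Notation Re := complex.Re.

(** Let [X] be the sum of the [b i * a * c i], let [M] be the matrix of the
    [tau (c i * b j)], and let [lambda] list its eigenvalues.

    Cyclic monotonicity and traciality of the weight give
    [w (X ^+ n) = w (a ^+ n) * \tr (M ^+ n) = w (a ^+ n) * \sum_i lambda i ^+ n]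
    for [n >= 2] ([weight_letter_word], [kappa_trace], [mxtrace_pow_eigen]): the
    power sums of [X] are those of the products of an eigenvalue of [a] with
    some [lambda i].  The restriction [n >= 2] comes from traciality, which only
    exchanges elements of the domain of [w], while the [b i] need not lie there;
    it is harmless, as the powers [n >= 2] determine the nonzero eigenvalues.

    An operator [x] realizing [X] is not normal, and passing from the traces of
    its powers to its algebraic multiplicities is usually the business of
    Lidskii's theorem.  That theorem is avoided here because the weight also
    knows the mixed moments: [w (star X ^+ m.+1 * X ^+ n.+1)] is
    [w (a ^+ (m + n).+2) * phi m n], where [phi m n] depends linearly on
    [M ^+ n] and grows at most geometrically ([letter_word_model]).  So for a
    polynomial [p] without constant term the Hilbert-Schmidt norm of [p(x)] is
    an explicit expression in the numbers [w (a ^+ n)].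

    On the side of [a], an operator [T] realizing it is selfadjoint, and for
    every [d > 0] it has finitely many eigenvalues [mu_j] outside a disc of
    radius [d] such that [w (a ^+ n)] is the sum of the [mu_j ^+ n] up to
    [O(d ^+ n)] ([spectral_moments]).  Consequently [p(x)] is small in
    Hilbert-Schmidt norm as soon as [p] vanishes at the finitely many products
    [mu_j * lambda i] and is small on a disc around [0] ([hs_norm2_le]).

    Fix [z != 0] and take [d] small compared with [z].  There are polynomials
    [f n] congruent to [1] modulo a high power of ['X - z], vanishing at the
    products [mu_j * lambda i] other than [z], and converging geometrically to
    [0] near [0] ([filter_polynomials]).  The operators [f n (x)] converge to a
    projection onto the generalized eigenspace of [x] at [z], and its rank, the
    limit of the traces of [f 0 (x) f n (x)], is the number of pairs [(j, i)]
    with [mu_j * lambda i = z] ([alg_mult_moments]).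

    The same computation for each [lambda i *: a], which has the single factor
    [lambda i], counts the indices [j] with [mu_j * lambda i = z]; summing over
    [i] gives the theorem. *)

(** * Real-valued norms on the complex numbers and on a Hilbert space *)

Section ComplexAbs.
Variable R : realType.
Implicit Types z w : R[i].

Lemma norm_normc z : `|z| = (normc z)%:C.
Proof. by []. Qed.

Lemma normc_ge0 z : 0 <= normc z.
Proof. by rewrite -ler0c -norm_normc. Qed.

Lemma normc_sum (I : Type) (r : seq I) (P : pred I) (F : I -> R[i]) :
  normc (\sum_(i <- r | P i) F i) <= \sum_(i <- r | P i) normc (F i).
Proof.
elim/big_ind2: _ => [|x1 x2 y1 y2 h1 h2|//]; first by rewrite normc0.
by apply: le_trans (le_normcD _ _) _; rewrite lerD.
Qed.

Lemma normcX z n : normc (z ^+ n) = normc z ^+ n.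
Proof. by elim: n => [|n IH]; rewrite ?normc1// !exprS normcM IH. Qed.

Lemma normc_real (x : R) : normc x%:C = `|x|.
Proof. by rewrite /= expr0n /= addr0 sqrtr_sqr. Qed.

Lemma normc_eq0 z : (normc z == 0) = (z == 0).
Proof. by apply/eqP/eqP => [/eq0_normc//|->]; rewrite normc0. Qed.

Lemma normc_gt0 z : (0 < normc z) = (z != 0).
Proof. by rewrite lt_def normc_eq0 normc_ge0 andbT. Qed.

Lemma normc_conj z : normc (Num.conj z) = normc z.
Proof. by case: z => a b /=; rewrite sqrrN. Qed.

Lemma mul_conj_normc z : z * Num.conj z = ((normc z) ^+ 2)%:C.
Proof. by rewrite -normCK norm_normc rmorphXn. Qed.

Lemma conj_realc (x : R) : Num.conj (x%:C : R[i]) = x%:C.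
Proof. exact: conjc_real. Qed.

Lemma le_Re_normc z : Re z <= normc z.
Proof.
rewrite (le_trans (ler_norm _))// -lecR; exact: normc_ge_Re.
Qed.

Lemma ReD z w : Re (z + w) = Re z + Re w.
Proof. by case: z w => ? ? [? ?]. Qed.
Lemma ReN z : Re (- z) = - Re z.
Proof. by case: z. Qed.

End ComplexAbs.

Section Hilbert.
Variables (R : realType) (H : hilbertType R).
Local Notation C := R[i].
Implicit Types u v : H.
Local Notation "'[ u , v ]" := (hdot H u v).

(** The norm as a real number: the norm of [H] takes values in [R[i]], whose order
    is partial and has no suprema. *)
Definition rnorm u : R := Re `|u|.

Lemma normr_rnorm u : `|u| = (rnorm u)%:C.
Proof. by rewrite /rnorm RRe_real// ger0_real. Qed.

Lemma rnorm_ge0 u : 0 <= rnorm u.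
Proof. by rewrite -ler0c -normr_rnorm. Qed.

Lemma rnorm0 : rnorm 0 = 0.
Proof. by rewrite /rnorm normr0. Qed.

Lemma rnorm_eq0 u : (rnorm u == 0) = (u == 0).
Proof.
apply/eqP/eqP => [h|->]; last exact: rnorm0.
by apply/eqP; rewrite -normr_eq0 normr_rnorm h.
Qed.

Lemma rnorm_gt0 u : (0 < rnorm u) = (u != 0).
Proof. by rewrite lt_def rnorm_eq0 rnorm_ge0 andbT. Qed.

Lemma rnormD u v : rnorm (u + v) <= rnorm u + rnorm v.
Proof. by rewrite -lecR rmorphD /= -!normr_rnorm ler_normD. Qed.

Lemma rnormN u : rnorm (- u) = rnorm u.
Proof. by rewrite /rnorm normrN. Qed.

Lemma rnormB u v : rnorm (u - v) = rnorm (v - u).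
Proof. by rewrite -rnormN opprB. Qed.

Lemma rnormZ (z : C) u : rnorm (z *: u) = normc z * rnorm u.
Proof.
by apply: (@complexI R); rewrite -normr_rnorm normrZ normr_rnorm norm_normc rmorphM.
Qed.

Lemma dotxx u : '[u, u] = ((rnorm u) ^+ 2)%:C.
Proof. by rewrite hdot_norm normr_rnorm rmorphXn. Qed.

Lemma dotDl u v w : '[u + v, w] = '[u, w] + '[v, w].
Proof. exact: linearDl. Qed.
Lemma dotDr u v w : '[u, v + w] = '[u, v] + '[u, w].
Proof. exact: linearDr. Qed.
Lemma dotZl z u v : '[z *: u, v] = z * '[u, v].
Proof. exact: linearZl_LR. Qed.
Lemma dotZr z u v : '[u, z *: v] = Num.conj z * '[u, v].
Proof. by rewrite linearZr_LR. Qed.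
Lemma dotNl u v : '[- u, v] = - '[u, v].
Proof. exact: linearNl. Qed.
Lemma dotNr u v : '[u, - v] = - '[u, v].
Proof. exact: linearNr. Qed.
Lemma dot0l v : '[0, v] = 0.
Proof. exact: linear0l. Qed.
Lemma dot0r v : '[v, 0] = 0.
Proof. exact: linear0r. Qed.
Lemma dotC u v : '[u, v] = Num.conj '[v, u].
Proof. by rewrite hermC expr0 mul1r. Qed.
Lemma dot_suml (I : Type) (r : seq I) (P : pred I) (F : I -> H) v :
  '[\sum_(i <- r | P i) F i, v] = \sum_(i <- r | P i) '[F i, v].
Proof. exact: linear_sumlz. Qed.
Lemma dot_sumr (I : Type) (r : seq I) (P : pred I) (F : I -> H) v :
  '[v, \sum_(i <- r | P i) F i] = \sum_(i <- r | P i) '[v, F i].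
Proof. exact: linear_sumr. Qed.

Lemma rnormB2 u v :
  (rnorm (u - v)) ^+ 2 = (rnorm u) ^+ 2 + (rnorm v) ^+ 2 - 2 * Re '[u, v].
Proof.
apply: (@complexI R); rewrite -dotxx dotDl !dotDr !dotNl !dotNr opprK !dotxx.
have e (z : C) : (2 * Re z)%:C = z + Num.conj z.
  by case: z => a b; apply/eqP; rewrite eq_complex /= subrr eqxx andbT; apply/eqP; ring.
rewrite (dotC v u) rmorphB rmorphD /= e; ring.
Qed.

Lemma rnorm2D u v : (rnorm (u + v)) ^+ 2 <= 2 * (rnorm u) ^+ 2 + 2 * (rnorm v) ^+ 2.
Proof.
apply: (@le_trans _ _ ((rnorm u + rnorm v) ^+ 2)).
  by rewrite lerXn2r ?nnegrE ?addr_ge0 ?rnorm_ge0// rnormD.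
rewrite -subr_ge0; have -> : 2 * rnorm u ^+ 2 + 2 * rnorm v ^+ 2 - (rnorm u + rnorm v) ^+ 2
  = (rnorm u - rnorm v) ^+ 2 by ring.
exact: sqr_ge0.
Qed.

Lemma CauchySchwarz_rnorm u v : normc '[u, v] <= rnorm u * rnorm v.
Proof.
have [->|v0] := eqVneq v 0; first by rewrite dot0r normc0 rnorm0 mulr0.
have n0 : 0 < rnorm v by rewrite rnorm_gt0.
have [w [wv eu]] : exists w, '[w, v] = 0 /\
    u = w + ('[u, v] * ((rnorm v) ^- 2)%:C) *: v.
  exists (u - ('[u, v] * ((rnorm v) ^- 2)%:C) *: v); rewrite subrK; split=> //.
  rewrite dotDl dotNl dotZl dotxx -mulrA -rmorphM /= mulVf ?mulr1 ?subrr//.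
  by rewrite expf_neq0// gt_eqF.
move: '[u, v] eu => d eu.
have e : (rnorm u) ^+ 2 = (rnorm w) ^+ 2 + (normc d) ^+ 2 / (rnorm v) ^+ 2.
  apply: (@complexI R); rewrite -dotxx eu.
  rewrite dotDl !dotDr !dotZl !dotZr wv (dotC v w) wv !dotxx.
  rewrite conjC0 !mulr0 addr0 add0r rmorphD /= rmorphM; congr (_ + _).
  rewrite rmorphM /= conj_realc [RHS]rmorphM /= -mul_conj_normc.
  have -> : (rnorm v ^- 2)%:C = ((rnorm v ^+ 2)%:C)^-1 :> C by rewrite fmorphV.
  have : (rnorm v ^+ 2)%:C != 0 :> C.
    by rewrite -[0]/(0%:C) (inj_eq (@complexI R)) expf_neq0// gt_eqF.
  by move: ((rnorm v ^+ 2)%:C : C) => x x0; move: (Num.conj d) => d'; field.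
rewrite -ler_sqr ?nnegrE ?mulr_ge0 ?normc_ge0 ?rnorm_ge0//.
rewrite exprMn e mulrDl divfK ?expf_neq0 ?gt_eqF// lerDr.
by rewrite mulr_ge0// sqr_ge0.
Qed.

Definition hcvg (v : nat -> H) (l : H) :=
  forall e : R, 0 < e -> exists N, forall n, (N <= n)%N -> rnorm (v n - l) <= e.

Lemma hcomplete (v : nat -> H) :
  (forall e : R, 0 < e ->
    exists N, forall n m, (N <= n)%N -> (N <= m)%N -> rnorm (v n - v m) <= e) ->
  exists l, hcvg v l.
Proof.
move=> hc; have : cvg (v @ \oo).
  apply/cauchy_cvgP/cauchy_exP => eps eps0.
  have [e e0 ee] : exists2 e : R, 0 < e & e%:C = eps.
    by exists (Re eps); [move: eps0; rewrite ltcE => /andP[]|rewrite RRe_real// gtr0_real].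
  have [N hN] := hc (e / 2) ltac:(by rewrite divr_gt0).
  exists (v N); exists N => // n /= Nn.
  rewrite -ball_normE /= normr_rnorm -ee ltcR.
  by apply: le_lt_trans (hN _ _ _ _) _; rewrite // ltr_pdivrMr// ltr_pMr// ltr1n.
move=> /cvgrPdist_le h; exists (lim (v @ \oo)) => e e0.
have [N _ hN] := h e%:C ltac:(by rewrite ltcR).
by exists N => n Nn; move: (hN _ Nn); rewrite normr_rnorm lecR rnormB.
Qed.

Lemma bounded_continuous (f : {linear H -> H}) : continuous f ->
  exists2 K : R, 0 < K & forall u, rnorm (f u) <= K * rnorm u.
Proof.
move=> cf; have := cf 0; rewrite /continuous_at linear0 => /cvgrPdist_le h.
have := h 1 ltr01; rewrite -nbhs_ballE => -[eps /= eps0 he].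
have [e e0 ee] : exists2 e : R, 0 < e & e%:C = eps.
  by exists (Re eps); [move: eps0; rewrite ltcE => /andP[]|rewrite RRe_real// gtr0_real].
exists (2 / e); first by rewrite divr_gt0.
move=> u; have [->|u0] := eqVneq u 0; first by rewrite linear0 rnorm0 mulr0.
have n0 : 0 < rnorm u by rewrite rnorm_gt0.
pose c : R := e / 2 / rnorm u.
have c0 : 0 < c by rewrite !divr_gt0.
have /= := he (c%:C *: u); rewrite sub0r normrN normr_rnorm.
rewrite -ball_normE /= sub0r normrN normr_rnorm rnormZ -ee ltcR linearZ rnormZ normc_real gtr0_norm//.
rewrite /c divfK ?gt_eqF// => /(_ ltac:(lra)).
rewrite (_ : 1 = (1 : R)%:C :> C)// lecR -/c mulrAC ler_pdivrMr// mul1r => h1.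
by rewrite mulrAC ler_pdivlMr//; lra.
Qed.

End Hilbert.

(** * Gram-Schmidt orthonormalization and Hilbert bases *)

Section Basis.
Variables (R : realType) (H : hilbertType R).
Local Notation C := R[i].
Implicit Types u v : H.
Local Notation "'[ u , v ]" := (hdot H u v).

Definition orthonormal_upto (m : nat) (u : nat -> H) :=
  forall i j, (i < m)%N -> (j < m)%N -> '[u i, u j] = (i == j)%:R.

Definition total_seq (s : nat -> H) :=
  forall v, (forall n, '[v, s n] = 0) -> v = 0.

Definition normalize v : H := ((rnorm v)^-1)%:C *: v.

Lemma normalizeK v : (rnorm v)%:C *: normalize v = v.
Proof.
have [->|v0] := eqVneq v 0; first by rewrite /normalize !scaler0.
by rewrite scalerA -rmorphM /= divff ?scale1r// rnorm_eq0.
Qed.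

Lemma rnorm_normalize v : v != 0 -> rnorm (normalize v) = 1.
Proof.
move=> v0; rewrite rnormZ normc_real ger0_norm ?invr_ge0 ?rnorm_ge0// mulVf//.
by rewrite rnorm_eq0.
Qed.

Lemma rnorm1_dot u : (rnorm u = 1) <-> ('[u, u] = 1).
Proof.
rewrite dotxx; split=> [->|]; first by rewrite expr1n.
move=> /complexI /eqP; rewrite sqrp_eq1 ?rnorm_ge0// => /eqP //.
Qed.

Section GramSchmidt.
Variable s : nat -> H.

Definition gs_step (l : seq H) v : H :=
  normalize (v - \sum_(e <- l) '[v, e] *: e).

Fixpoint gs_seq n : seq H :=
  if n is n'.+1 then rcons (gs_seq n') (gs_step (gs_seq n') (s n')) else [::].

Definition gs n := gs_step (gs_seq n) (s n).

Lemma gs_seqE n : gs_seq n = mkseq gs n.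
Proof. by elim: n => [//|n IH]; rewrite mkseqS -IH. Qed.

Lemma gsE n : gs n = normalize (s n - \sum_(i < n) '[s n, gs i] *: gs i).
Proof. by rewrite /gs /gs_step gs_seqE big_map -val_enum_ord big_map big_enum. Qed.

Lemma gs_unit n : gs n = 0 \/ '[gs n, gs n] = 1.
Proof.
rewrite gsE; set v := (s n - _); have [->|v0] := eqVneq v 0.
  by left; rewrite /normalize scaler0.
by right; apply/rnorm1_dot/rnorm_normalize.
Qed.

Lemma gs_ortho_lt n i : (i < n)%N -> '[gs n, gs i] = 0.
Proof.
elim/ltn_ind: n i => n IH i lin.
rewrite {1}gsE /normalize dotZl; set r := (X in X * _); move: r => r.
rewrite dotDl dotNl dot_suml (bigD1 (Ordinal lin))//= big1.
  rewrite addr0 dotZl; case: (gs_unit i) => [->|->].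
    by rewrite dot0r mul0r subrr mulr0.
  by rewrite mulr1 subrr mulr0.
move=> j /negbTE ji; rewrite dotZl.
suff -> : '[gs j, gs i] = 0 by rewrite mulr0.
case: (ltngtP j i) => [lji|lij|e].
- by rewrite dotC IH// conjC0.
- by rewrite IH// ltn_ord.
- by move: ji; rewrite -(inj_eq val_inj)/= e eqxx.
Qed.

(** Each [s n] lies in the span of the first [n.+1] vectors, so a vector
    orthogonal to the whole family is orthogonal to [s]. *)
Lemma gs_total : total_seq s -> hilbert_basis gs.
Proof.
move=> hs; split; first exact: gs_unit.
  move=> n m; case: (ltngtP n m) => [nm _|nm _|//]; last exact: gs_ortho_lt.
  by rewrite dotC gs_ortho_lt// conjC0.
move=> v hv; apply: hs => n.
have : s n = (rnorm (s n - \sum_(i < n) '[s n, gs i] *: gs i))%:C *: gs n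
      + \sum_(i < n) '[s n, gs i] *: gs i.
  by rewrite gsE normalizeK subrK.
move=> ->; rewrite dotDr dotZr hv mulr0 add0r dot_sumr big1// => i _.
by rewrite dotZr hv mulr0.
Qed.

Lemma gs_id m : orthonormal_upto m s -> forall i, (i < m)%N -> gs i = s i.
Proof.
move=> ho; elim/ltn_ind => i IH im.
rewrite gsE big1 => [|j _].
  rewrite subr0 /normalize; have -> : rnorm (s i) = 1.
    by apply/rnorm1_dot; rewrite ho// eqxx.
  by rewrite invr1 scale1r.
have jm : (j < m)%N by apply: ltn_trans im.
by rewrite IH// ho// gtn_eqF// scale0r.
Qed.

End GramSchmidt.

(** A vector orthogonal to a dense set is at distance less than its own norm
    from a vector orthogonal to it, hence is zero. *)
Lemma separable_total : separable H -> exists s, total_seq s.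
Proof.
move=> [S [/pcard_leP/unsquash g dS]].
pose s n := xget (0 : H) [set v | S v /\ g v = n].
exists s => v hv; apply/eqP/negPn/negP => v0.
have [w [/= wv Sw]] : (ball v `|v| `&` S !=set0).
  by apply: dS; [exists v; apply: ballxx; rewrite normr_gt0|exact: ball_open].
have sw : s (g w) = w.
  rewrite /s; case: xgetP => [y _ [Sy gy]|/(_ w)]; last by case.
  by apply: (@inj _ _ _ g) => //; rewrite inE.
have /eqP := hv (g w); rewrite sw => /eqP vw.
have vvw : '[v, v] = '[v, v - w] by rewrite dotDr dotNr vw subr0.
have := CauchySchwarz_rnorm v (v - w); rewrite -vvw dotxx normc_real.
move: wv; rewrite -ball_normE /= !normr_rnorm ltcR => wv.
have n0 : 0 < rnorm v by rewrite rnorm_gt0.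
rewrite ger0_norm ?sqr_ge0// expr2 ler_pM2l// leNgt; by rewrite wv.
Qed.

(** The traces of a realization are prescribed along every Hilbert basis; a basis
    adapted to a given orthonormal family turns such a trace into information
    about that family. *)
Lemma basis_extension m (u : nat -> H) : separable H -> orthonormal_upto m u ->
  exists2 e, hilbert_basis e & forall i, (i < m)%N -> e i = u i.
Proof.
move=> /separable_total[t ht] hu.
pose s n := if (n < m)%N then u n else t (n - m)%N.
exists (gs s).
  apply: gs_total => v hv; apply: ht => n.
  by have := hv (m + n)%N; rewrite /s ltnNge leq_addr /= addKn.
move=> i im; rewrite (@gs_id s m)//; first by rewrite /s im.
by move=> j k jm km; rewrite /s jm km hu.
Qed.

End Basis.

(** * Limits of complex sequences *)

Section ComplexLimits.
Variable R : realType.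
Local Notation C := R[i].
Implicit Types (f g : nat -> C) (t u z : C).

Definition cplx_cvg f (t : C) :=
  forall e : R, 0 < e -> exists N, forall n, (N <= n)%N -> normc (f n - t) <= e.

(** Limits of complex sequences are handled by real error bounds. *)
Lemma cplx_cvgP f t :
  ((f : nat -> C^o) @ \oo --> (t : C^o)) <-> cplx_cvg f t.
Proof.
split.
  move=> /cvgrPdist_le h e e0.
  have [N _ hN] := h e%:C ltac:(by rewrite ltcR).
  exists N => n Nn; move: (hN _ Nn); rewrite -lecR -norm_normc distrC//.
move=> h; apply/cvgrPdist_le => eps eps0.
have [e e0 ee] : exists2 e : R, 0 < e & e%:C = eps.
  by exists (Re eps); [move: eps0; rewrite ltcE => /andP[]|rewrite RRe_real// gtr0_real].
have [N hN] := h e e0; exists N => // n Nn.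
by have := hN _ Nn; rewrite -lecR -norm_normc distrC ee.
Qed.

Lemma cplx_cvgD f g t u : cplx_cvg f t -> cplx_cvg g u -> cplx_cvg (fun n => f n + g n) (t + u).
Proof.
move=> hf hg e e0; have e2 : 0 < e / 2 by rewrite divr_gt0.
have [N hN] := hf _ e2; have [M hM] := hg _ e2.
exists (maxn N M) => n; rewrite geq_max => /andP[Nn Mn].
have -> : f n + g n - (t + u) = (f n - t) + (g n - u) by ring.
apply: le_trans (le_normcD _ _) _; have := hN _ Nn; have := hM _ Mn; lra.
Qed.

Lemma cplx_cvgZ f t z : cplx_cvg f t -> cplx_cvg (fun n => z * f n) (z * t).
Proof.
move=> hf e e0; have d0 : 0 < normc z + 1 by have := normc_ge0 z; lra.
have [N hN] := hf (e / (normc z + 1)) ltac:(by rewrite divr_gt0).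
exists N => n Nn; rewrite -mulrBr normcM.
have := hN _ Nn; rewrite ler_pdivlMr// => h.
by have := normc_ge0 z; have := normc_ge0 (f n - t); nra.
Qed.

Lemma cplx_cvg_conj f t : cplx_cvg f t -> cplx_cvg (fun n => Num.conj (f n)) (Num.conj t).
Proof.
move=> hf e e0; have [N hN] := hf _ e0; exists N => n Nn.
by rewrite -rmorphB normc_conj hN.
Qed.

Lemma cplx_cvg_cst t : cplx_cvg (fun=> t) t.
Proof. by move=> e e0; exists 0%N => n _; rewrite subrr normc0 ltW. Qed.

Lemma cplx_cvg_ext f g t : f =1 g -> cplx_cvg f t -> cplx_cvg g t.
Proof. by move=> fg h e /h[N hN]; exists N => n /hN; rewrite fg. Qed.

Lemma cplx_cvg_sum (I : Type) (r : seq I) (P : pred I) (F : I -> nat -> C) (t : I -> C) :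
  (forall i, P i -> cplx_cvg (F i) (t i)) ->
  cplx_cvg (fun n => \sum_(i <- r | P i) F i n) (\sum_(i <- r | P i) t i).
Proof.
move=> h; elim: r => [|i r IH].
  by rewrite big_nil; apply: cplx_cvg_ext (cplx_cvg_cst 0) => n; rewrite big_nil.
rewrite big_cons; case: ifP => Pi.
  by apply: cplx_cvg_ext (cplx_cvgD (h _ Pi) IH) => n; rewrite big_cons Pi.
by apply: cplx_cvg_ext IH => n; rewrite big_cons Pi.
Qed.

Lemma cplx_cvg_uniq f t u : cplx_cvg f t -> cplx_cvg f u -> t = u.
Proof.
move=> hf hg; apply/eqP; rewrite -subr_eq0 -normc_eq0 eq_le normc_ge0 andbT.
apply/ler_addgt0Pl => e e0; rewrite addr0.
have e2 : 0 < e / 2 by rewrite divr_gt0.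
have [N hN] := hf _ e2; have [M hM] := hg _ e2.
have := hN _ (leq_maxl N M); have := hM _ (leq_maxr N M); set x := f _.
move=> h1 h2; have -> : t - u = (x - u) - (x - t) by ring.
apply: le_trans (le_normcD _ _) _; rewrite normcN; lra.
Qed.

Lemma cplx_cvg_le f t (b : R) :
  (exists N, forall n, (N <= n)%N -> normc (f n) <= b) -> cplx_cvg f t -> normc t <= b.
Proof.
move=> [N hN] hf; apply/ler_addgt0Pl => e e0.
have [M hM] := hf _ e0.
have := hN _ (leq_maxl N M); have := hM _ (leq_maxr N M); set x := f _.
move=> h1 h2; have -> : t = x - (x - t) by ring.
apply: le_trans (le_normcD _ _) _; rewrite normcN; lra.
Qed.

Lemma cplx_cvg_ge_partial (g : nat -> R) f t :
  (forall n, 0 <= g n) -> (forall n, f n = (\sum_(i < n) g i)%:C) ->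
  cplx_cvg f t -> forall n, \sum_(i < n) g i <= Re t.
Proof.
move=> g0 fg hf n; apply/ler_addgt0Pl => e e0.
have [N hN] := hf _ e0.
have := hN _ (leq_maxl N n); rewrite fg => h.
apply: (@le_trans _ _ (\sum_(i < maxn N n) g i)).
  rewrite -!(big_mkord xpredT g) [leRHS](@big_cat_nat _ _ _ n)//= ?leq_maxr//.
  by rewrite lerDl sumr_ge0.
have := le_Re_normc (((\sum_(i < maxn N n) g i))%:C - t).
rewrite ReD ReN /=; lra.
Qed.

End ComplexLimits.

Lemma has_trace_cplx_cvg (R : realType) (H : hilbertType R) (f : H -> H) t e :
  has_trace f t -> hilbert_basis e ->
  cplx_cvg (fun n => \sum_(i < n) hdot H (f (e i)) (e i)) t.
Proof.
move=> hf he; have /cplx_cvgP := hf e he; apply: cplx_cvg_ext => n.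
by rewrite /series /= big_mkord.
Qed.

(** * Polynomials of an operator and their traces *)

Section PolynomialAction.
Variables (R : realType) (H : hilbertType R) (x : {linear H -> H}).
Local Notation C := R[i].
Implicit Types (u v : H) (p q : {poly C}).
Local Notation "'[ u , v ]" := (hdot H u v).

(** The value of the polynomial [p] at the operator [x]; constant terms act by
    scaling, although only polynomials without constant term have traces. *)
Definition poly_act p u : H := \sum_(i < size p) p`_i *: iter i x u.

Lemma poly_act_widen n p u : (size p <= n)%N ->
  poly_act p u = \sum_(i < n) p`_i *: iter i x u.
Proof.
move=> coef_norm; rewrite /poly_act (big_ord_widen n (fun i => p`_i *: iter i x u) coef_norm).
rewrite big_mkcond /=; apply: eq_bigr => i _; case: ltnP => // /(nth_default 0) ->.
by rewrite scale0r.
Qed.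

Lemma poly_actD p q u : poly_act (p + q) u = poly_act p u + poly_act q u.
Proof.
pose n := maxn (size p) (size q).
rewrite !(@poly_act_widen n) ?size_polyD ?leq_maxl ?leq_maxr//.
by rewrite -big_split; apply: eq_bigr => i _; rewrite coefD scalerDl.
Qed.

Lemma poly_actZ c p u : poly_act (c *: p) u = c *: poly_act p u.
Proof.
rewrite !(@poly_act_widen (size p)) ?size_scale_leq// scaler_sumr.
by apply: eq_bigr => i _; rewrite coefZ scalerA.
Qed.

Lemma poly_actN p u : poly_act (- p) u = - poly_act p u.
Proof. by rewrite -scaleN1r poly_actZ scaleN1r. Qed.

Lemma poly_actC c u : poly_act c%:P u = c *: u.
Proof.
by rewrite (@poly_act_widen 1) ?size_polyC ?leq_b1// big_ord1 coefC.
Qed.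

Lemma iter_linear n : linear (iter n x : H -> H).
Proof. by elim: n => [//|n IH] a u v /=; rewrite IH linearP. Qed.

Lemma poly_act_linear p : linear (poly_act p).
Proof.
move=> a u v; rewrite /poly_act scaler_sumr -big_split; apply: eq_bigr => i _ /=.
by rewrite iter_linear scalerDr !scalerA mulrC.
Qed.
HB.instance Definition _ p := GRing.isLinear.Build C H H *:%R (poly_act p) (poly_act_linear p).

Lemma poly_actDr p u v : poly_act p (u + v) = poly_act p u + poly_act p v.
Proof. exact: linearD. Qed.
Lemma poly_actBr p u v : poly_act p (u - v) = poly_act p u - poly_act p v.
Proof. exact: linearB. Qed.
Lemma poly_actZr p a u : poly_act p (a *: u) = a *: poly_act p u.
Proof. exact: linearZ. Qed.

Lemma poly_actMX p u : poly_act (p * 'X) u = x (poly_act p u).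
Proof.
rewrite (@poly_act_widen (size p).+1); last first.
  by apply: leq_trans (size_polyMleq _ _) _; rewrite size_polyX addnC.
rewrite big_ord_recl coefMX eqxx scale0r add0r /poly_act linear_sum.
by apply: eq_bigr => i _; rewrite linearZ coefMX.
Qed.

Lemma poly_actM p q u : poly_act (p * q) u = poly_act p (poly_act q u).
Proof.
elim/poly_ind: p u => [|p c IH] u; first by rewrite mul0r -[0]/(0%:P) !poly_actC !scale0r.
rewrite mulrDl !poly_actD -mulrA (mulrC 'X) mulrA !poly_actMX IH mul_polyC poly_actZ.
by rewrite poly_actC.
Qed.

Lemma iter_poly_act z n u : iter n (fun v => x v - z *: v) u = poly_act (('X - z%:P) ^+ n) u.
Proof.
elim: n => [|n IH]; first by rewrite expr0 -[1]/(1%:P) poly_actC scale1r.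
rewrite exprSr mulrBr poly_actD poly_actN poly_actMX (mulrC _ z%:P) mul_polyC poly_actZ.
by rewrite /= IH.
Qed.

Lemma poly_act_dvd p q u : p %| q -> poly_act p u = 0 -> poly_act q u = 0.
Proof. by move=> /dvdpP[r ->] h; rewrite poly_actM h linear0. Qed.

Lemma poly_act_bounded p : continuous x ->
  exists2 K : R, 0 < K & forall u, rnorm (poly_act p u) <= K * rnorm u.
Proof.
move=> /bounded_continuous[K K0 hK].
elim/poly_ind: p => [|p c [L L0 IH]].
  by exists 1 => // u; rewrite -[0]/(0%:P) poly_actC scale0r rnorm0 mul1r rnorm_ge0.
exists (K * L + normc c + 1) => [|u].
  by apply: ltr_wpDl => //; rewrite addr_ge0 ?normc_ge0// mulr_ge0// ltW.
rewrite poly_actD poly_actMX poly_actC; apply: le_trans (rnormD _ _) _; rewrite rnormZ !mulrDl mul1r.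
have h1 := hK (poly_act p u); have h2 := IH u; have h3 := rnorm_ge0 u.
have h4 : K * rnorm (poly_act p u) <= K * L * rnorm u by rewrite -mulrA ler_pM2l.
by lra.
Qed.

End PolynomialAction.

Section Moments.
Variables (R : realType) (H : hilbertType R).
Local Notation C := R[i].
Implicit Types (p q : {poly C}) (x : {linear H -> H}).
Local Notation "'[ u , v ]" := (hdot H u v).

Definition has_moments x (m1 : nat -> C) := forall n, (0 < n)%N ->
  forall e, hilbert_basis e ->
    cplx_cvg (fun N => \sum_(i < N) '[iter n x (e i), e i]) (m1 n).

Definition has_star_moments x (m2 : nat -> nat -> C) := forall m n, (0 < m + n)%N ->
  forall e, hilbert_basis e ->
    cplx_cvg (fun N => \sum_(i < N) '[iter n x (e i), iter m x (e i)]) (m2 m n).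

(** The trace of [p(x)], computed from the moments. *)
Definition poly_trace (m1 : nat -> C) p : C := \sum_(i < size p) p`_i * m1 i.

(** The Hilbert-Schmidt inner product of [q(x)] and [p(x)], computed from the
    star moments. *)
Definition hs_form (m2 : nat -> nat -> C) p q : C :=
  \sum_(i < size p) \sum_(j < size q) Num.conj p`_i * q`_j * m2 i j.

Lemma poly_trace_cplx_cvg x m1 p e : has_moments x m1 -> p`_0 = 0 -> hilbert_basis e ->
  cplx_cvg (fun N => \sum_(i < N) '[poly_act x p (e i), e i]) (poly_trace m1 p).
Proof.
move=> hm p0 he.
have h (i : 'I_(size p)) : true -> cplx_cvg
    (fun N => p`_i * \sum_(j < N) '[iter i x (e j), e j]) (p`_i * m1 i).
  move=> _; case: i => -[|i] /= Hi.
    by rewrite p0; apply: cplx_cvg_ext (cplx_cvg_cst _) => n; rewrite !mul0r.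
  by apply: cplx_cvgZ; exact: (hm i.+1 isT e he).
apply: cplx_cvg_ext (cplx_cvg_sum _ h) => n.
under eq_bigr do rewrite mulr_sumr.
rewrite exchange_big; apply: eq_bigr => j _ /=.
by rewrite /poly_act dot_suml; apply: eq_bigr => i _; rewrite dotZl.
Qed.

Lemma hs_form_cplx_cvg x m2 p q e : has_star_moments x m2 -> p`_0 = 0 -> hilbert_basis e ->
  cplx_cvg (fun N => \sum_(i < N) '[poly_act x q (e i), poly_act x p (e i)]) (hs_form m2 p q).
Proof.
move=> hm p0 he.
have h (i : 'I_(size p)) : true -> cplx_cvg
    (fun N => \sum_(j < size q) Num.conj p`_i * q`_j *
        \sum_(k < N) '[iter j x (e k), iter i x (e k)])
    (\sum_(j < size q) Num.conj p`_i * q`_j * m2 i j).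
  move=> _; apply: cplx_cvg_sum => j _; case: i => -[|i] /= Hi.
    by rewrite p0 conjC0; apply: cplx_cvg_ext (cplx_cvg_cst _) => n; rewrite !mul0r.
  by apply: cplx_cvgZ; exact: (hm i.+1 j isT e he).
apply: cplx_cvg_ext (cplx_cvg_sum _ h) => n.
under eq_bigr do under eq_bigr do rewrite mulr_sumr.
under eq_bigr do rewrite exchange_big.
rewrite exchange_big; apply: eq_bigr => k _ /=.
rewrite /poly_act dot_sumr; apply: eq_bigr => i _; rewrite dot_suml.
by apply: eq_bigr => j _; rewrite dotZl dotZr mulrCA mulrA.
Qed.

Definition hs_norm2 m2 p : R := Re (hs_form m2 p p).

Lemma hs_norm2_partial x m2 p e N : has_star_moments x m2 -> p`_0 = 0 -> hilbert_basis e ->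
  \sum_(i < N) (rnorm (poly_act x p (e i))) ^+ 2 <= hs_norm2 m2 p.
Proof.
move=> hm p0 he; have := cplx_cvg_ge_partial _ _ (hs_form_cplx_cvg p hm p0 he).
move=> /(_ (fun i => (rnorm (poly_act x p (e i))) ^+ 2)); apply.
  by move=> n; rewrite sqr_ge0.
by move=> n; rewrite rmorph_sum; apply: eq_bigr => i _; rewrite dotxx.
Qed.

(** The operator norm is at most the Hilbert-Schmidt norm: compute the latter in
    a basis whose first vector is proportional to [u]. *)
Lemma hs_norm2_bound x m2 p u : separable H -> has_star_moments x m2 -> p`_0 = 0 ->
  (rnorm (poly_act x p u)) ^+ 2 <= hs_norm2 m2 p * (rnorm u) ^+ 2.
Proof.
move=> sH hm p0; have [->|u0] := eqVneq u 0.
  by rewrite linear0 rnorm0 expr0n mulr0.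
have [e he e0] := @basis_extension _ _ 1 (fun=> normalize u) sH
  ltac:(by move=> [|//] [|//] _ _; rewrite eqxx; apply/rnorm1_dot/rnorm_normalize).
have := hs_norm2_partial 1 hm p0 he; rewrite big_ord1 e0//.
have := rnorm_normalize u0; have := normalizeK u; move: (normalize u) => w uw w1 h.
rewrite -{1}uw linearZ rnormZ exprMn normc_real ger0_norm ?rnorm_ge0// mulrC.
by apply: ler_wpM2r => //; rewrite sqr_ge0.
Qed.

End Moments.

(** * Algebraic multiplicities from filtering polynomials *)

Lemma exists_last (P : nat -> Prop) (B : nat) : P 0%N -> (forall m, P m -> (m <= B)%N) ->
  exists m, P m /\ ~ P m.+1.
Proof.
move=> P0 PB; apply: contrapT => h.
have hP : forall m, P m.
  elim=> [//|m Pm]; apply: contrapT => nP; by apply: h; exists m.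
by have := PB _ (hP B.+1); rewrite ltnn.
Qed.

Lemma le_sqr_ratio (R : realType) (e a : R) : 0 < e -> 0 <= a ->
  (e / (a + 1)) ^+ 2 * a ^+ 2 <= e ^+ 2.
Proof.
move=> e0 a0; have d0 : 0 < a + 1 by rewrite ltr_wpDl.
have h0 : 0 <= e / (a + 1) * a by rewrite mulr_ge0// divr_ge0// ltW.
rewrite -exprMn lerXn2r ?nnegrE ?(ltW e0)//; apply: ltW.
by rewrite mulrAC ltr_pdivrMr// ltr_pM2l// ltrDl.
Qed.

Section Multiplicity.
Variables (R : realType) (H : hilbertType R).
Local Notation C := R[i].
Implicit Types (p q : {poly C}) (u : nat -> H).
Local Notation "'[ u , v ]" := (hdot H u v).

Lemma orthonormal_extend m u (v : H) : orthonormal_upto m u ->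
  (forall i, (i < m)%N -> '[v, u i] = 0) -> v != 0 ->
  orthonormal_upto m.+1 (fun i => if (i < m)%N then u i else normalize v).
Proof.
move=> hu hv v0 i j; rewrite !ltnS => im jm.
case: ltnP => im'; case: ltnP => jm'.
- exact: hu.
- rewrite /normalize dotZr dotC hv// conjC0 mulr0.
  by rewrite ltn_eqF//; apply: leq_trans jm'.
- rewrite /normalize dotZl hv// mulr0.
  by rewrite gtn_eqF//; apply: leq_trans im'.
have -> : i = m by apply/anti_leq; rewrite im im'.
have -> : j = m by apply/anti_leq; rewrite jm jm'.
by rewrite eqxx; apply/rnorm1_dot/rnorm_normalize.
Qed.

(** Otherwise the normalized residual of [v] would extend the family. *)
Lemma orthonormal_maximal m u (V : set H) :
  (forall (z : C) v w, V v -> V w -> V (v + z *: w)) -> orthonormal_upto m u ->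
  (forall i, (i < m)%N -> V (u i)) ->
  (~ exists u', orthonormal_upto m.+1 u' /\ forall i, (i < m.+1)%N -> V (u' i)) ->
  forall v, V v -> v = \sum_(i < m) '[v, u i] *: u i.
Proof.
move=> hV hu Vu hmax v Vv; apply: contrapT => hv; apply: hmax.
pose w := v - \sum_(i < m) '[v, u i] *: u i.
have w0 : w != 0 by rewrite subr_eq0; apply/eqP.
have hVs n : (n <= m)%N -> V (v - \sum_(i < n) '[v, u i] *: u i).
  elim: n => [_|n IH nm]; first by rewrite big_ord0 subr0.
  rewrite big_ord_recr opprD addrA -scaleNr; apply: hV (IH (ltnW nm)) _.
  exact: Vu.
have Vw : V (normalize w).
  have -> : normalize w = w + (((rnorm w)^-1)%:C - 1) *: w.
    by rewrite scalerBl scale1r addrCA subrr addr0.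
  by apply: hV; apply: hVs.
exists (fun i => if (i < m)%N then u i else normalize w); split.
  apply: orthonormal_extend => // i im.
  rewrite dotDl dotNl dot_suml (bigD1 (Ordinal im))//= big1.
    by rewrite dotZl hu// eqxx mulr1 addr0 subrr.
  by move=> j; rewrite -val_eqE /= => /negbTE ji; rewrite dotZl hu// ji mulr0.
by move=> i _; case: ltnP => // im; apply: Vu.
Qed.

Variables (x y : {linear H -> H}) (m1 : nat -> C) (m2 m2' : nat -> nat -> C).
Hypothesis sH : separable H.
Hypothesis cx : continuous x.
Hypothesis xy : adjoint x y.
Hypothesis hm1 : has_moments x m1.
Hypothesis hm2 : has_star_moments x m2.
Hypothesis hm2' : has_star_moments y m2'.

Lemma iter_adjoint n (u v : H) : '[iter n x u, v] = '[u, iter n y v].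
Proof. by elim: n u v => [//|n IH] u v; rewrite iterSr IH xy. Qed.

Lemma poly_act_adjoint p (u v : H) :
  '[poly_act x p u, v] = '[u, poly_act y (map_poly Num.conj p) v].
Proof.
rewrite (@poly_act_widen _ _ y (size p)) ?size_poly// dot_suml dot_sumr.
apply: eq_bigr => i _; rewrite dotZl dotZr iter_adjoint coef_map.
by rewrite /= conjCK.
Qed.

Section Projection.
Variables (z : C) (r : nat) (f : {poly C}).
Hypothesis f1 : ('X - z%:P) ^+ r %| 1 - f.

(** On the kernel of [(x - z) ^+ r] only the residue of [f] modulo
    [('X - z) ^+ r] matters. *)
Lemma poly_act_fix (u : H) : poly_act x (('X - z%:P) ^+ r) u = 0 -> poly_act x f u = u.
Proof.
move=> hu; have := poly_act_dvd f1 hu.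
by rewrite poly_actD poly_actN -[1]/(1%:P) poly_actC scale1r => /subr0_eq.
Qed.
End Projection.

Lemma hs_norm2_small p (u : H) :
  (forall e : R, 0 < e -> exists2 q : {poly C}, q`_0 = 0 /\ hs_norm2 m2 q <= e &
    poly_act x p u = poly_act x q u) ->
  poly_act x p u = 0.
Proof.
move=> h; apply/eqP; rewrite -rnorm_eq0 -sqrf_eq0 eq_le sqr_ge0 andbT.
apply/ler_addgt0Pl => e e0; rewrite addr0.
have d0 : 0 < (rnorm u) ^+ 2 + 1 by rewrite ltr_wpDl ?sqr_ge0.
have [q [q0 hq] ->] := h (e / ((rnorm u) ^+ 2 + 1)) ltac:(by rewrite divr_gt0).
apply: le_trans (hs_norm2_bound u sH hm2 q0) _.
move: hq; rewrite ler_pdivlMr// => hq; apply: le_trans hq.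
have := hs_norm2_partial 1 hm2 q0.
have [b hb _] := @basis_extension _ _ 0 (fun=> 0) sH ltac:(by []).
move=> /(_ _ hb); rewrite big_ord1 => h2.
have h3 : 0 <= hs_norm2 m2 q by apply: le_trans h2; exact: sqr_ge0.
by rewrite mulrDr mulr1 lerDl.
Qed.

(** For [u] in the kernel of [(x - z) ^+ r] we have [u = f(x) u], and
    [(x - z) ^+ k f(x)] is as small as desired; so the generalized eigenspace is
    reached at the exponent [k]. *)
Lemma ker_stab z r k (u : H) :
  (forall e : R, 0 < e -> exists f : {poly C}, [/\ f`_0 = 0, ('X - z%:P) ^+ r %| 1 - f &
     hs_norm2 m2 (('X - z%:P) ^+ k * f) <= e]) ->
  poly_act x (('X - z%:P) ^+ r) u = 0 -> poly_act x (('X - z%:P) ^+ k) u = 0.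
Proof.
move=> h hu; apply: hs_norm2_small => e e0.
have [f [f0 f1 hf]] := h e e0; exists (('X - z%:P) ^+ k * f).
  by split=> //; rewrite coef0M f0 mulr0.
by rewrite poly_actM (poly_act_fix f1 hu).
Qed.

Section Trace.
Variables (z : C) (k c : nat) (f : nat -> {poly C}).
Hypothesis f0 : forall n, (f n)`_0 = 0.
Hypothesis f1 : forall n, ('X - z%:P) ^+ k %| 1 - f n.
Hypothesis fC : forall e : R, 0 < e -> exists N, forall n m, (N <= n)%N -> (N <= m)%N ->
  hs_norm2 m2 (f n - f m) <= e.
Hypothesis fk : forall e : R, 0 < e -> exists N, forall n, (N <= n)%N ->
  hs_norm2 m2 (('X - z%:P) ^+ k * f n) <= e.
Hypothesis ft : cplx_cvg (fun n => poly_trace m1 (f 0%N * f n)) c%:R.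

Let V : set H := fun v => poly_act x (('X - z%:P) ^+ k) v = 0.

Let V_lin (a : C) (v w : H) : V v -> V w -> V (v + a *: w).
Proof. by rewrite /V => hv hw; rewrite poly_actDr poly_actZr hv hw scaler0 addr0. Qed.

Let fB0 n m : (f n - f m)`_0 = 0.
Proof. by rewrite coefB !f0 subrr. Qed.

(** The operators [f n (x)] form a Cauchy sequence for the Hilbert-Schmidt norm,
    and the limit is killed by [(x - z) ^+ k] because [(x - z) ^+ k f n (x)]
    tends to [0]. *)
Lemma proj_limit (u : H) : exists2 l, hcvg (fun n => poly_act x (f n) u) l & V l.
Proof.
have [|l hl] := @hcomplete _ H (fun n => poly_act x (f n) u).
  move=> e e0; have d0 : 0 < rnorm u + 1 by rewrite ltr_wpDl ?rnorm_ge0.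
  have [N hN] := fC (e := (e / (rnorm u + 1)) ^+ 2) ltac:(by rewrite exprn_gt0// divr_gt0).
  exists N => n m Nn Nm.
  rewrite -poly_actN -poly_actD -ler_sqr ?nnegrE ?rnorm_ge0 ?(ltW e0)//.
  apply: le_trans (hs_norm2_bound u sH hm2 (fB0 n m)) _.
  apply: le_trans (ler_wpM2r (sqr_ge0 _) (hN _ _ Nn Nm)) _.
  by apply: le_sqr_ratio; rewrite ?rnorm_ge0.
exists l => //; rewrite /V; apply/eqP; rewrite -rnorm_eq0 eq_le rnorm_ge0 andbT.
apply/ler_addgt0Pl => e e0; rewrite addr0.
have [K K0 hK] := poly_act_bounded (('X - z%:P) ^+ k) cx.
have [N hN] := hl (e / 2 / K) ltac:(by rewrite !divr_gt0).
have d0 : 0 < rnorm u + 1 by rewrite ltr_wpDl ?rnorm_ge0.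
have [M hM] := fk (e := (e / 2 / (rnorm u + 1)) ^+ 2) ltac:(by rewrite exprn_gt0// !divr_gt0).
pose n := maxn N M; have := hN n (leq_maxl _ _); have := hM n (leq_maxr _ _).
move: (f0 n) (poly_actM x (('X - z%:P) ^+ k) (f n) u).
move: (f n) => g g0 gM hg hgl.
have -> : poly_act x (('X - z%:P) ^+ k) l
  = poly_act x (('X - z%:P) ^+ k * g) u - poly_act x (('X - z%:P) ^+ k) (poly_act x g u - l).
  by rewrite poly_actBr gM subKr.
apply: le_trans (rnormD _ _) _; rewrite rnormN [leRHS](splitr e) lerD//; last first.
  by apply: le_trans (hK _) _; rewrite mulrC -ler_pdivlMr.
rewrite -ler_sqr ?nnegrE ?rnorm_ge0// ?divr_ge0 ?(ltW e0)//.
apply: le_trans (hs_norm2_bound u sH hm2 _) _; first by rewrite coef0M g0 mulr0.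
apply: le_trans (ler_wpM2r (sqr_ge0 _) hg) _.
by apply: le_sqr_ratio; rewrite ?rnorm_ge0 ?divr_gt0.
Qed.

(** [f 0 (x)] is the identity on [V] and is Hilbert-Schmidt, so [V] is
    finite-dimensional. *)
Lemma ker_orthonormal_bound : exists B, forall m,
  (exists u, orthonormal_upto m u /\ forall i, (i < m)%N -> V (u i)) -> (m <= B)%N.
Proof.
exists (Num.bound (hs_norm2 m2 (f 0%N))) => m [u [hu Vu]].
have [e he eu] := basis_extension sH hu.
have := hs_norm2_partial m hm2 (f0 0) he.
rewrite (eq_bigr (fun=> 1)); last first.
  move=> i _; rewrite eu// (poly_act_fix (f1 0) (Vu _ _))//.
  have -> : rnorm (u i) = 1 by apply/rnorm1_dot; rewrite hu// eqxx.
  by rewrite expr1n.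
rewrite sumr_const card_ord => h; rewrite -(ler_nat R) (le_trans h)//.
by rewrite ltW// archi_boundP// (le_trans _ h)// ler0n.
Qed.

Lemma sum_limit (e : nat -> H) (l : nat -> H) n :
  (forall i, hcvg (fun n => poly_act x (f n) (e i)) (l i)) ->
  forall eta : R, 0 < eta -> exists M, forall m, (M <= m)%N ->
    \sum_(i < n) (rnorm (poly_act x (f m) (e i) - l i)) ^+ 2 <= eta.
Proof.
move=> hl; elim: n => [|n IH] eta eta0.
  by exists 0%N => m _; rewrite big_ord0 ltW.
have e2 : 0 < eta / 2 by rewrite divr_gt0.
have [M hM] := IH _ e2.
have [N hN] := hl n (Num.sqrt (eta / 2)) ltac:(by rewrite sqrtr_gt0).
exists (maxn M N) => m; rewrite geq_max => /andP[Mm Nm].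
rewrite big_ord_recr /= (splitr eta) lerD ?hM//.
rewrite -(sqr_sqrtr (ltW e2)) lerXn2r ?nnegrE ?sqrtr_ge0 ?rnorm_ge0//.
by apply: hN.
Qed.

(** In a Hilbert basis starting with an orthonormal basis of [V], the first [m]
    diagonal entries of [f 0 (x) f n (x)] are [1].  The others tend to [0] in
    sum: [f n (x) e_i] is close to its limit [l i] in [V], [f 0 (x)] fixes [l i],
    and [e_i] is orthogonal to [V].  Composing with the fixed [f 0 (x)] makes the
    sum of the errors a Hilbert-Schmidt pairing, bounded by Cauchy-Schwarz. *)
Lemma ker_dim : exists u, [/\ orthonormal_upto c u, forall i, (i < c)%N -> V (u i) &
  forall v, V v -> v = \sum_(i < c) '[v, u i] *: u i].
Proof.
have [B hB] := ker_orthonormal_bound.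
have [|m [[u [hu Vu]] hmax]] := exists_last (P := fun m => exists u,
    orthonormal_upto m u /\ forall i, (i < m)%N -> V (u i)) _ hB.
  by exists (fun=> 0); split=> // i.
have hspan := orthonormal_maximal V_lin hu Vu hmax.
suff -> : c = m by exists u.
have [e he eu] := basis_extension sH hu.
have [l hl] : exists l, forall i, hcvg (fun n => poly_act x (f n) (e i)) (l i) /\ V (l i).
  have /choice[l hl] : forall i, exists l, hcvg (fun n => poly_act x (f n) (e i)) l /\ V l.
    by move=> i; have [l h1 h2] := proj_limit (e i); exists l.
  by exists l.
have Vorth v i : V v -> (m <= i)%N -> '[v, e i] = 0.
  move=> /hspan -> mi; rewrite dot_suml big1// => j _.
  rewrite dotZl -eu//; case: he => _ -> //; first by rewrite mulr0.
  by rewrite ltn_eqF// (leq_trans (ltn_ord j)).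
pose D := hs_norm2 m2' (map_poly Num.conj (f 0%N)).
have D0 : 0 <= D.
  apply: le_trans (hs_norm2_partial 0 hm2' _ he); rewrite ?big_ord0//.
  by rewrite coef_map f0 /= conjC0.
suff : cplx_cvg (fun n => poly_trace m1 (f 0%N * f n)) m%:R.
  move=> /(cplx_cvg_uniq ft) /eqP; rewrite eqr_nat => /eqP //.
move=> eps eps0.
(* The final estimate is [d * (4 + D)]. *)
pose d := eps / (4 + D).
have d0 : 0 < d by rewrite divr_gt0// ltr_wpDr.
have [N hN] := fC (e := d ^+ 2) ltac:(by rewrite exprn_gt0).
exists N => n Nn.
have f00 : (f 0%N * f n)`_0 = 0 by rewrite coef0M f0 mul0r.
have := cplx_cvgD (poly_trace_cplx_cvg hm1 f00 he) (cplx_cvg_cst (- m%:R)).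
apply: cplx_cvg_le; exists m => M mM.
rewrite -(big_mkord xpredT (fun i => '[poly_act x (f 0%N * f n) (e i), e i])).
rewrite (@big_cat_nat _ _ _ m)//=.
rewrite (@eq_big_nat _ _ _ 0%N m _ (fun=> 1)); last first.
  move=> i /andP[_ im]; rewrite poly_actM eu// (poly_act_fix (f1 n)) ?(poly_act_fix (f1 0))//;
    try exact: Vu.
  by rewrite hu// eqxx.
rewrite sumr_const_nat subn0 addrAC subrr add0r.
have hx i : (m <= i)%N -> normc '[poly_act x (f 0%N * f n) (e i), e i] <=
   d^-1 * (rnorm (poly_act x (f n) (e i) - l i)) ^+ 2 +
   d * (rnorm (poly_act y (map_poly Num.conj (f 0%N)) (e i))) ^+ 2.
  move=> mi; have [_ Vl] := hl i.
  have -> : '[poly_act x (f 0%N * f n) (e i), e i] =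
    '[poly_act x (f n) (e i) - l i, poly_act y (map_poly Num.conj (f 0%N)) (e i)].
    rewrite -poly_act_adjoint poly_actBr poly_actM dotDl dotNl (poly_act_fix (f1 0) Vl).
    by rewrite (Vorth _ _ Vl mi) subr0.
  apply: le_trans (CauchySchwarz_rnorm _ _) _.
  move: (rnorm (poly_act x (f n) (e i) - l i))
    (rnorm (poly_act y (map_poly Num.conj (f 0%N)) (e i))) (rnorm_ge0 (poly_act x (f n) (e i) - l i))
    (rnorm_ge0 (poly_act y (map_poly Num.conj (f 0%N)) (e i))) => a b a0 b0.
  rewrite -subr_ge0.
  have -> : d^-1 * a ^+ 2 + d * b ^+ 2 - a * b =
    d^-1 * ((a - d * b / 2) ^+ 2 + 3 / 4 * (d * b) ^+ 2).
    by field; rewrite gt_eqF.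
  have di : 0 <= d^-1 by rewrite invr_ge0 (ltW d0).
  apply: (mulr_ge0 di).
  have := sqr_ge0 (a - d * b / 2); have := sqr_ge0 (d * b); lra.
apply: le_trans (normc_sum _ _ _) _.
apply: (@le_trans _ _ (\sum_(m <= i < M)
   (d^-1 * (rnorm (poly_act x (f n) (e i) - l i)) ^+ 2 +
   d * (rnorm (poly_act y (map_poly Num.conj (f 0%N)) (e i))) ^+ 2))).
  by apply: ler_sum_nat => i /andP[mi _]; apply: hx.
apply: (@le_trans _ _ (\sum_(0 <= i < M)
   (d^-1 * (rnorm (poly_act x (f n) (e i) - l i)) ^+ 2 +
   d * (rnorm (poly_act y (map_poly Num.conj (f 0%N)) (e i))) ^+ 2))).
  rewrite [leRHS](@big_cat_nat _ _ _ m)//= lerDr sumr_ge0// => i _.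
  by rewrite addr_ge0// mulr_ge0 ?sqr_ge0 ?invr_ge0 ?(ltW d0).
rewrite big_mkord big_split -!mulr_sumr /=.
have b1 : \sum_(i < M) (rnorm (poly_act y (map_poly Num.conj (f 0%N)) (e i))) ^+ 2 <= D.
  by apply: hs_norm2_partial => //; rewrite coef_map f0 /= conjC0.
have b2 : \sum_(i < M) (rnorm (poly_act x (f n) (e i) - l i)) ^+ 2 <= 4 * d ^+ 2.
  have [M' hM'] := sum_limit M (fun i => proj1 (hl i)) (eta := d ^+ 2) ltac:(by rewrite exprn_gt0).
  pose q := maxn N M'.
  apply: (@le_trans _ _ (\sum_(i < M) (2 * (rnorm (poly_act x (f n - f q) (e i))) ^+ 2
      + 2 * (rnorm (poly_act x (f q) (e i) - l i)) ^+ 2))).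
    apply: ler_sum => i _.
    have -> : poly_act x (f n) (e i) - l i =
      poly_act x (f n - f q) (e i) + (poly_act x (f q) (e i) - l i).
      by rewrite poly_actD poly_actN addrA subrK.
    exact: rnorm2D.
  rewrite big_split -!mulr_sumr /=.
  have h1 := hs_norm2_partial M hm2 (fB0 n q) he.
  have h2 := hN _ _ Nn (leq_maxl N M').
  have h3 := hM' _ (leq_maxr N M').
  rewrite -/q in h2 h3; move: h1 h2 h3; lra.
apply: (@le_trans _ _ (d^-1 * (4 * d ^+ 2) + d * D)).
  by apply: lerD; apply: ler_wpM2l => //; rewrite ?invr_ge0 (ltW d0).
have -> : d^-1 * (4 * d ^+ 2) + d * D = d * (4 + D) by field; rewrite gt_eqF.
by rewrite /d divfK// gt_eqF// ltr_wpDr.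
Qed.

End Trace.

(** The exponent [r] is arbitrary but [k] is not: the filters of every order [r]
    show that the generalized eigenspace is the kernel of [(x - z) ^+ k], and
    those of order [k] compute its dimension. *)
Lemma alg_mult_moments z k c :
  (forall r, exists f : nat -> {poly C}, [/\ forall n, (f n)`_0 = 0,
    forall n, ('X - z%:P) ^+ r %| 1 - f n,
    forall e : R, 0 < e -> exists N, forall n m, (N <= n)%N -> (N <= m)%N ->
      hs_norm2 m2 (f n - f m) <= e,
    forall e : R, 0 < e -> exists N, forall n, (N <= n)%N ->
      hs_norm2 m2 (('X - z%:P) ^+ k * f n) <= e &
    cplx_cvg (fun n => poly_trace m1 (f 0%N * f n)) c%:R]) ->
  alg_mult x z c.
Proof.
move=> h; have [f [f0 f1 fC fk ft]] := h k.
have [u [hu Vu Vs]] := ker_dim f0 f1 fC fk ft.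
exists (fun i : 'I_c => u i); split.
- by move=> i; exists k; rewrite iter_poly_act; apply: Vu.
- move=> a a0 i; have : '[\sum_i a i *: u i, u i] = 0 by rewrite a0 dot0l.
  rewrite dot_suml (bigD1 i)//= big1 => [|j ji].
    by rewrite dotZl hu// eqxx mulr1 addr0.
  by rewrite dotZl hu// (inj_eq val_inj) (negbTE ji) mulr0.
move=> v [r]; rewrite iter_poly_act => hv; exists (fun i => '[v, u i]).
apply: Vs; apply: ker_stab hv => e e0.
have [g [g0 g1 _ gk _]] := h r; have [N hN] := gk _ e0.
by exists (g N); split=> //; apply: hN.
Qed.

End Multiplicity.

(** * Moments of a selfadjoint Hilbert-Schmidt operator *)

Lemma nonincreasing_Cauchy (R : realType) (h : nat -> R) :
  (forall n, 0 <= h n) -> (forall n, h n.+1 <= h n) ->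
  forall e, 0 < e -> exists N, forall n, (N <= n)%N -> h N - e <= h n <= h N.
Proof.
move=> h0 hd e e0.
have hm n k : h (n + k)%N <= h n.
  by elim: k => [|k IH]; rewrite ?addn0// addnS (le_trans (hd _)).
have hi : has_inf (range h).
  by split; [exists (h 0%N), 0%N|exists 0 => _ [n _ <-]].
have [_ [N _ <-] hN] := inf_adherent e0 hi.
exists N => n Nn; have -> : h n <= h N by rewrite -(subnKC Nn) hm.
rewrite andbT lerBlDr.
apply: le_trans (ltW hN) _; rewrite lerD2r.
by apply: ge_inf; [case: hi|exists n => //; rewrite subnKC].
Qed.

Lemma Bernoulli_le (R : realType) (e : R) n : 0 <= e <= 1 ->
  1 - n%:R * e <= (1 - e) ^+ n.
Proof.
move=> /andP[e0 e1]; elim: n => [|n IH]; first by rewrite mul0r subr0.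
rewrite exprS -natr1.
have h : (1 - e) * (1 - n%:R * e) <= (1 - e) * (1 - e) ^+ n.
  by rewrite ler_wpM2l// subr_ge0.
apply: le_trans h; rewrite -subr_ge0.
have -> : (1 - e) * (1 - n%:R * e) - (1 - (n%:R + 1) * e) = n%:R * e ^+ 2 by ring.
by rewrite mulr_ge0// sqr_ge0.
Qed.

Section Spectral.
Variables (R : realType) (H : hilbertType R) (T : {linear H -> H}).
Local Notation C := R[i].
Local Notation "'[ u , v ]" := (hdot H u v).
Variable m1 : nat -> C.
Hypothesis sH : separable H.
Hypothesis cT : continuous T.
Hypothesis TT : adjoint T T.
Hypothesis hm1 : has_moments T m1.

Let TZ a v : T (a *: v) = a *: T v. Proof. exact: linearZ. Qed.
Let TB v w : T (v - w) = T v - T w. Proof. exact: linearB. Qed.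
Let TD v w : T (v + w) = T v + T w. Proof. exact: linearD. Qed.

Lemma dot_iter n k (u v : H) : '[iter n T u, iter k T v] = '[iter (n + k) T u, v].
Proof. by rewrite (iter_adjoint TT) -iterD -(iter_adjoint TT). Qed.

Lemma rnorm_iter2 n (v : H) : ((rnorm (iter n T v)) ^+ 2)%:C = '[iter (n + n) T v, v].
Proof. by rewrite -dotxx dot_iter. Qed.

Lemma dot_iter_rnorm n k (v : H) : '[iter (2 * n) T v, iter (2 * k) T v]
  = ((rnorm (iter (n + k) T v)) ^+ 2)%:C.
Proof. by rewrite rnorm_iter2 dot_iter addnn -mul2n mulnDr. Qed.

Lemma iter_moment_cplx_cvg e n : hilbert_basis e -> (0 < n)%N ->
  cplx_cvg (fun N => (\sum_(i < N) (rnorm (iter n T (e i))) ^+ 2)%:C) (m1 (n + n)).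
Proof.
move=> he n0; have := hm1 (n := (n + n)%N) _ he; rewrite addn_gt0 n0 => /(_ isT).
by apply: cplx_cvg_ext => N; rewrite rmorph_sum; apply: eq_bigr => i _ /=; rewrite rnorm_iter2.
Qed.

Lemma iter_moment_partial e n N : hilbert_basis e -> (0 < n)%N ->
  \sum_(i < N) (rnorm (iter n T (e i))) ^+ 2 <= Re (m1 (n + n)).
Proof.
move=> he n0; have := cplx_cvg_ge_partial _ _ (iter_moment_cplx_cvg he n0).
by move=> /(_ (fun i => (rnorm (iter n T (e i))) ^+ 2)); apply => // i; exact: sqr_ge0.
Qed.

Lemma iter_scale n (a : C) (v : H) : iter n T (a *: v) = a *: iter n T v.
Proof. by elim: n => [//|n IH] /=; rewrite IH TZ. Qed.

Lemma iter_eigen n (a : C) (v : H) : T v = a *: v -> iter n T v = a ^+ n *: v.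
Proof.
move=> hv; elim: n => [|n IH]; first by rewrite expr0 scale1r.
by rewrite iterSr hv iter_scale IH scalerA exprS.
Qed.

(** By Cauchy-Schwarz and selfadjointness the sequence of the norms of the
    [T^n v] is log-convex, so its successive ratios are nondecreasing. *)
Lemma rnorm_iter_ge (v : H) n : rnorm v = 1 -> (rnorm (T v)) ^+ n <= rnorm (iter n T v).
Proof.
move=> v1; have [T0|T0] := eqVneq (rnorm (T v)) 0.
  by case: n => [|n]; rewrite ?T0 ?expr0 /= ?v1// expr0n rnorm_ge0.
have tp : 0 < rnorm (T v) by rewrite lt_def T0 rnorm_ge0.
suff : rnorm (T v) ^+ n <= rnorm (iter n T v) /\
       rnorm (T v) * rnorm (iter n T v) <= rnorm (iter n.+1 T v) by case.
elim: n => [|n [IH1 IH2]]; first by rewrite expr0 /= v1 mulr1.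
have h0 : 0 < rnorm (iter n T v) by apply: lt_le_trans IH1; rewrite exprn_gt0.
split.
  by apply: le_trans IH2; rewrite exprS ler_pM2l.
have h2 : rnorm (iter n.+1 T v) ^+ 2 <= rnorm (iter n.+2 T v) * rnorm (iter n T v).
  have := CauchySchwarz_rnorm (iter n.+2 T v) (iter n T v).
  by rewrite dot_iter addSnnS -rnorm_iter2 normc_real ger0_norm// sqr_ge0.
have h1 : 0 < rnorm (iter n.+1 T v) by apply: lt_le_trans IH2; rewrite mulr_gt0.
rewrite -(ler_pM2r h0); apply: le_trans h2.
by rewrite expr2 mulrAC ler_wpM2r// ltW.
Qed.

Variable d : R.
Hypothesis d0 : 0 < d.

Definition eigenfamily m (u : nat -> H) (mu : nat -> C) :=
  orthonormal_upto m u /\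
  forall i, (i < m)%N -> T (u i) = mu i *: u i /\ d <= normc (mu i).

(** The Hilbert-Schmidt norm of [T] bounds the number of orthonormal eigenvectors
    with eigenvalue of modulus at least [d]. *)
Lemma eigenfamily_bound m u mu : eigenfamily m u mu ->
  (m <= Num.bound (Re (m1 2) / d ^+ 2))%N.
Proof.
move=> [hu hT]; have [e he eu] := basis_extension sH hu.
have := iter_moment_partial m he (n := 1) isT.
have : m%:R * d ^+ 2 <= \sum_(i < m) rnorm (iter 1 T (e i)) ^+ 2.
  rewrite mulr_natl -[X in _ *+ X](card_ord m) -sumr_const; apply: ler_sum => i _ /=.
  have [e1 e2] := hT i (ltn_ord i); rewrite eu// e1 rnormZ.
  have -> : rnorm (u i) = 1 by apply/rnorm1_dot; rewrite hu// eqxx.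
  by rewrite mulr1 lerXn2r ?nnegrE ?normc_ge0 ?(ltW d0).
move=> h1 h2; have := le_trans h1 h2.
rewrite -ler_pdivlMr ?exprn_gt0// => h; rewrite -(ler_nat R) (le_trans h)//.
by rewrite ltW// archi_boundP// (le_trans _ h)// ler0n.
Qed.

Section Complement.
Variables (m : nat) (u : nat -> H) (mu : nat -> C).
Hypothesis hu : eigenfamily m u mu.
Hypothesis hmax : forall u' mu', ~ eigenfamily m.+1 u' mu'.

Let W (v : H) := forall i, (i < m)%N -> '[v, u i] = 0.

Let WT v : W v -> W (T v).
Proof.
move=> hv i im; rewrite TT; have [-> _] := (proj2 hu) i im.
by rewrite dotZr hv// mulr0.
Qed.

Let WTn n v : W v -> W (iter n T v).
Proof. by move=> hv; elim: n => [//|n IH] /=; apply: WT. Qed.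

Let WD v w : W v -> W w -> W (v + w).
Proof. by move=> hv hw i im; rewrite dotDl hv// hw// addr0. Qed.

Let WZ a v : W v -> W (a *: v).
Proof. by move=> hv i im; rewrite dotZl hv// mulr0. Qed.

Lemma complement_no_eigen (a : C) v : W v -> T v = a *: v -> d <= normc a -> v = 0.
Proof.
move=> Wv hv ha; apply/eqP/negPn/negP => v0.
apply: (@hmax (fun i => if (i < m)%N then u i else normalize v)
  (fun i => if (i < m)%N then mu i else a)).
split; first by apply: orthonormal_extend => //; case: hu.
move=> i _; case: ifP => im; first exact: (proj2 hu).
by rewrite /normalize TZ hv scalerA mulrC -scalerA.
Qed.

Section NormOnComplement.
Variable t : R.
Hypothesis dt : d < t.
Hypothesis ht : forall v, W v -> rnorm (T v) <= t * rnorm v.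

Let t0 : 0 < t. Proof. exact: lt_trans dt. Qed.

Let ht_iter n v : W v -> rnorm (iter n T v) <= t ^+ n * rnorm v.
Proof.
move=> Wv; elim: n => [|n IH]; first by rewrite expr0 mul1r.
by apply: le_trans (ht (WTn n Wv)) _; rewrite exprS -mulrA ler_pM2l.
Qed.

(** The even powers of [T / t]: odd powers would oscillate when [- t] is an
    eigenvalue. *)
Let scaled v n : H := (t ^- (2 * n))%:C *: iter (2 * n) T v.

(** The sequence [h n], the squared norm of [(T / t)^n v], is nonincreasing, which
    makes the [scaled v n] a Cauchy sequence.  Its limit [l] satisfies
    [T (T l) = t^2 l]; then [T l + t l] is zero or an eigenvector for [t], and in
    the former case [l] is zero or an eigenvector for [- t].  The maximality of
    the family excludes both eigenvectors. *)
Lemma power_limit0 v : W v -> forall e, 0 < e ->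
  exists N, forall n, (N <= n)%N -> rnorm (scaled v n) <= e.
Proof.
move=> Wv.
pose h n : R := (rnorm (iter n T v)) ^+ 2 / t ^+ (2 * n).
have tn n : 0 < t ^+ n by rewrite exprn_gt0.
have h_ge0 n : 0 <= h n by rewrite divr_ge0 ?sqr_ge0// ltW.
have h_dec n : h n.+1 <= h n.
  rewrite /h ler_pdivrMr// mulrAC ler_pdivlMr//.
  rewrite (_ : (2 * n.+1 = 2 + 2 * n)%N); last by rewrite mulnS.
  rewrite exprD mulrA ler_pM2r// mulrC -exprMn.
  by rewrite lerXn2r ?nnegrE ?mulr_ge0 ?rnorm_ge0 ?(ltW t0)//; apply: ht; exact: WTn.
have hsc n k : (rnorm (scaled v n - scaled v k)) ^+ 2 =
    h (2 * n)%N + h (2 * k)%N - 2 * h (n + k)%N.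
  rewrite rnormB2 /scaled dotZl dotZr dot_iter_rnorm conj_realc -!rmorphM /=.
  rewrite !rnormZ !normc_real !ger0_norm ?invr_ge0 ?(ltW (tn _))// /h !exprMn !exprVn.
  rewrite -!exprM !(mulnC _ 2%N) mulnDr exprD.
  have := tn (2 * n)%N; have := tn (2 * k)%N => *.
  by rewrite invfM; ring.
have hC := nonincreasing_Cauchy h_ge0 h_dec.
have [|l hl] := @hcomplete _ H (scaled v).
  move=> e e0; have [N hN] := hC (e ^+ 2 / 2) ltac:(by rewrite divr_gt0// exprn_gt0).
  exists N => n k Nn Nk; rewrite -ler_sqr ?nnegrE ?rnorm_ge0 ?(ltW e0)// hsc.
  have /andP[_ b1] := hN (2 * n)%N ltac:(by rewrite (leq_trans Nn)// leq_pmull).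
  have /andP[_ b2] := hN (2 * k)%N ltac:(by rewrite (leq_trans Nk)// leq_pmull).
  have /andP[b3 _] := hN (n + k)%N ltac:(by rewrite (leq_trans Nn)// leq_addr).
  lra.
have Wl : W l.
  move=> i im; apply/eqP; rewrite -normc_eq0 eq_le normc_ge0 andbT.
  apply/ler_addgt0Pl => e e0; rewrite addr0.
  have [N hN] := hl e e0; have := hN N (leqnn N).
  have Ws : W (scaled v N) by apply/WZ/WTn.
  have -> : '[l, u i] = - '[scaled v N - l, u i] by rewrite dotDl dotNl Ws// sub0r opprK.
  rewrite normcN => h1; apply: le_trans (CauchySchwarz_rnorm _ _) _.
  have -> : rnorm (u i) = 1 by apply/rnorm1_dot; rewrite (proj1 hu)// eqxx.
  by rewrite mulr1.
have Tl : T (T l) = (t ^+ 2)%:C *: l.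
  have [K K0 hK] := bounded_continuous cT.
  apply/eqP; rewrite -subr_eq0 -rnorm_eq0 eq_le rnorm_ge0 andbT.
  apply/ler_addgt0Pl => e e0; rewrite addr0.
  pose D := K * K + t ^+ 2.
  have D0 : 0 < D by rewrite addr_gt0 ?mulr_gt0.
  have [N hN] := hl (e / D) ltac:(by rewrite divr_gt0).
  have b1 := hN N (leqnn N); have b2 := hN N.+1 (leqnSn N).
  have sc : T (T (scaled v N)) = (t ^+ 2)%:C *: scaled v N.+1.
    rewrite /scaled (_ : (2 * N.+1 = (2 * N).+2)%N); last by rewrite mulnS.
    rewrite !TZ scalerA -rmorphM /=; congr (_%:C *: _).
    by rewrite -[(2 * N).+2]/(2 + 2 * N)%N exprD invfM mulrA mulfV ?mul1r// expf_neq0// gt_eqF.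
  have -> : T (T l) - (t ^+ 2)%:C *: l =
     (t ^+ 2)%:C *: (scaled v N.+1 - l) - T (T (scaled v N - l)).
    by rewrite scalerBr -sc !TB opprB [RHS]addrC addrA subrK.
  apply: le_trans (rnormD _ _) _; rewrite rnormN rnormZ normc_real ger0_norm ?sqr_ge0//.
  apply: (@le_trans _ _ (t ^+ 2 * (e / D) + K * (K * (e / D)))); last first.
    by rewrite mulrA -mulrDl addrC mulrC divfK// gt_eqF.
  apply: lerD; first by rewrite ler_pM2l// exprn_gt0.
  apply: le_trans (hK _) _; rewrite ler_pM2l//.
  by apply: le_trans (hK _) _; rewrite ler_pM2l.
have tc : d <= normc t%:C by rewrite normc_real gtr0_norm// ltW.
have l0 : l = 0.
  have w0 : T l + t%:C *: l = 0.
    apply: (@complement_no_eigen t%:C) => //.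
      by apply: WD; [exact: WT|exact: WZ].
    by rewrite TD TZ Tl scalerDr scalerA -rmorphM -expr2 addrC.
  apply: (@complement_no_eigen (- t%:C)) => //; last by rewrite normcN.
  by rewrite scaleNr; apply/eqP; rewrite -addr_eq0 w0.
by move=> e /hl[N hN]; exists N => n /hN; rewrite l0 subr0.
Qed.

(** A quantitative form of the fact that [T] attains its norm on [W].  By
    [power_limit0] and the summability of the squared norms of the [T (e i)], the
    Hilbert-Schmidt norm of the restriction of [(T / t)^(2n)] to [W] drops below
    [1] for some [n]; it dominates the operator norm of that restriction. *)
Lemma complement_norm_drop : exists2 N, (0 < N)%N &
  forall v, W v -> rnorm v = 1 -> (rnorm (T v)) ^+ N <= 3 / 4 * t ^+ N.
Proof.
have [e he eu] := basis_extension sH (proj1 hu).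
have We i : (m <= i)%N -> W (e i).
  move=> mi j jm; rewrite -eu//; case: he => _ -> //.
  by rewrite gtn_eqF// (leq_trans jm).
(* Beyond [K] the squared norms of the [T (e i)] contribute at most half of
   [t ^+ 2]; the finitely many vectors before [K] are left to [power_limit0]. *)
have [K mK hK] : exists2 K, (m <= K)%N & forall M, (K <= M)%N ->
    \sum_(K <= i < M) (rnorm (T (e i))) ^+ 2 <= t ^+ 2 / 2.
  have t4 : 0 < t ^+ 2 / 4 by rewrite divr_gt0// exprn_gt0.
  have [K hK] := iter_moment_cplx_cvg he (n := 1) isT t4.
  exists (maxn m K) => [|M]; first exact: leq_maxl.
  rewrite geq_max => /andP[mM KM].
  have b1 := hK _ (leq_maxr m K); have b2 := hK _ KM.
  have mm : (maxn m K <= M)%N by rewrite geq_max mM.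
  move: b2; rewrite -(big_mkord xpredT (fun i => rnorm (iter 1 T (e i)) ^+ 2)).
  rewrite (@big_cat_nat _ _ _ (maxn m K))//= big_mkord rmorphD /=.
  move: b1 => /=; set a := (\sum_(i < _) _)%:C; set b := \sum_(_ <= i < _) _.
  move=> b1 b2.
  have b00 : 0 <= b by rewrite /b sumr_ge0// => i _; rewrite sqr_ge0.
  have -> : b = normc ((a + b%:C - m1 2) - (a - m1 2)).
    by rewrite (_ : _ - _ = b%:C); [rewrite normc_real ger0_norm|ring].
  by apply: le_trans (le_normcD _ _) _; rewrite normcN; lra.
have [n n0 hn4] : exists2 n, (0 < n)%N &
    \sum_(m <= i < K) (rnorm (scaled (e i) n)) ^+ 2 <= 1 / 4.
  have h : forall M eta, 0 < eta -> exists N, forall n, (N <= n)%N ->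
      \sum_(m <= i < M) (rnorm (scaled (e i) n)) ^+ 2 <= eta.
    elim=> [|M IH] eta eta0.
      by exists 0%N => n _; rewrite big_geq// ltW.
    have [mM|mM] := leqP m M; last by exists 0%N => n _; rewrite big_geq// ltW.
    have e2 : 0 < eta / 2 by rewrite divr_gt0.
    have [N1 hN1] := IH _ e2.
    have [N2 hN2] := power_limit0 (We _ mM) (e := Num.sqrt (eta / 2)) ltac:(by rewrite sqrtr_gt0).
    exists (maxn N1 N2) => n; rewrite geq_max => /andP[N1n N2n].
    rewrite big_nat_recr//= (splitr eta) lerD ?hN1//.
    rewrite -(sqr_sqrtr (ltW e2)) lerXn2r ?nnegrE ?sqrtr_ge0 ?rnorm_ge0//.
    by apply: hN2.
  have [N hN] := h K (1 / 4) ltac:(by rewrite divr_gt0).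
  by exists N.+1 => //; apply: hN.
have tn k : 0 < t ^+ k by rewrite exprn_gt0.
pose S := \sum_(i < m) (rnorm (iter (2 * n) T (u i))) ^+ 2.
have n20 : (0 < 2 * n)%N by rewrite muln_gt0.
have hS : normc (m1 (2 * n + 2 * n) - S%:C) <= 3 / 4 * t ^+ (4 * n).
  have := cplx_cvgD (iter_moment_cplx_cvg he n20) (cplx_cvg_cst (- S%:C)).
  apply: cplx_cvg_le; exists K => M KM.
  rewrite -rmorphN -rmorphD normc_real.
  rewrite -(big_mkord xpredT (fun i => rnorm (iter (2 * n) T (e i)) ^+ 2)).
  rewrite (@big_cat_nat _ _ _ m)//=; last exact: leq_trans KM.
  rewrite big_mkord (eq_bigr (fun i : 'I_m => rnorm (iter (2 * n) T (u i)) ^+ 2)).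
    rewrite -/S addrAC subrr add0r ger0_norm; last first.
      by rewrite sumr_ge0// => i _; rewrite sqr_ge0.
    rewrite (@big_cat_nat _ _ _ K)//=.
    have -> : 3 / 4 * t ^+ (4 * n) = 1 / 4 * t ^+ (4 * n) + t ^+ (4 * n) / 2 by field.
    apply: lerD.
      rewrite -ler_pdivrMr// mulr_suml; apply: le_trans hn4.
      apply: ler_sum => i _; rewrite /scaled rnormZ normc_real ger0_norm ?invr_ge0 ?(ltW (tn _))//.
      rewrite exprMn mulrC exprVn -exprM.
      by rewrite (_ : (2 * n * 2 = 4 * n)%N)// mulnAC.
    apply: (@le_trans _ _ (\sum_(K <= i < M) t ^+ (2 * (2 * n).-1) * rnorm (T (e i)) ^+ 2)).
      apply: ler_sum_nat => i /andP[Ki _].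
      have -> : iter (2 * n) T (e i) = iter (2 * n).-1 T (T (e i)).
        by rewrite -iterSr prednK.
      rewrite (mulnC 2 (2 * n).-1) exprM -exprMn lerXn2r ?nnegrE ?mulr_ge0 ?rnorm_ge0 ?(ltW (tn _))//.
      by apply: ht_iter; apply/WT/We; rewrite (leq_trans mK).
    rewrite -mulr_sumr.
    apply: le_trans (ler_wpM2l (ltW (tn _)) (hK _ KM)) _.
    rewrite mulrA -exprD (_ : (2 * (2 * n).-1 + 2 = 4 * n)%N)//.
    by case: (n) n0 => // k _; lia.
  by move=> i _; rewrite eu.
exists (4 * n)%N; first by rewrite muln_gt0.
move=> v Wv v1.
have v0 : v != 0 by rewrite -rnorm_eq0 v1 oner_eq0.
have [e' he' eu'] := basis_extension sH (orthonormal_extend (proj1 hu) Wv v0).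
have := iter_moment_partial m.+1 he' n20.
rewrite big_ord_recr /= eu'// ltnn /normalize v1 invr1 scale1r.
rewrite (eq_bigr (fun i : 'I_m => rnorm (iter (2 * n) T (u i)) ^+ 2)); last first.
  by move=> i _; rewrite eu' ?ltn_ord// ltnS ltnW.
rewrite -/S => h1.
have h2 := le_Re_normc (m1 (2 * n + 2 * n) - S%:C).
rewrite ReD ReN /= in h2.
have h3 := rnorm_iter_ge (2 * n) v1.
have h4 : (rnorm (T v) ^+ (2 * n)) ^+ 2 <= rnorm (iter (2 * n) T v) ^+ 2.
  by rewrite lerXn2r ?nnegrE ?exprn_ge0 ?rnorm_ge0.
rewrite -exprM (_ : (2 * n * 2 = 4 * n)%N) in h4; last by rewrite mulnAC.
lra.
Qed.

End NormOnComplement.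

(** If the supremum [t] of the norms of [T w] over the unit vectors of [W]
    exceeded [d], then [complement_norm_drop] would make it smaller than [t]. *)
Lemma complement_norm v : W v -> rnorm (T v) <= d * rnorm v.
Proof.
move=> Wv; rewrite leNgt; apply/negP => hv.
pose E : set R := [set rnorm (T w) | w in [set w | W w /\ rnorm w = 1]].
have v0 : v != 0 by apply: contraTneq hv => ->; rewrite linear0 rnorm0 mulr0 ltxx.
have vp : 0 < rnorm v by rewrite rnorm_gt0.
have Ev : E (rnorm (T (normalize v))).
  by exists (normalize v) => //; split; [exact: WZ|exact: rnorm_normalize].
have Elt : d < rnorm (T (normalize v)).
  rewrite /normalize TZ rnormZ normc_real ger0_norm ?invr_ge0 ?(ltW vp)//.
  by rewrite mulrC ltr_pdivlMr.
have [K K0 hK] := bounded_continuous cT.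
have hs : has_sup E.
  split; first by exists (rnorm (T (normalize v))).
  by exists K => _ [w [_ w1] <-]; have := hK w; rewrite w1 mulr1.
pose t := sup E.
have dt : d < t by apply: lt_le_trans Elt _; apply: ub_le_sup Ev; case: hs.
have t0 : 0 < t by apply: lt_trans dt.
have ht w : W w -> rnorm (T w) <= t * rnorm w.
  move=> Ww; have [->|w0] := eqVneq w 0; first by rewrite linear0 rnorm0 mulr0.
  have wp : 0 < rnorm w by rewrite rnorm_gt0.
  have : rnorm (T (normalize w)) <= t.
    apply: ub_le_sup; first by case: hs.
    by exists (normalize w) => //; split; [exact: WZ|exact: rnorm_normalize].
  rewrite /normalize TZ rnormZ normc_real ger0_norm ?invr_ge0 ?(ltW wp)//.
  by rewrite mulrC ler_pdivrMr.
have [N N0 hN] := complement_norm_drop dt ht.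
(* By Bernoulli's inequality [(1 - eps) ^+ N] is at least [7 / 8 > 3 / 4]. *)
pose eps : R := (8 * N%:R)^-1.
have N0r : 0 < N%:R :> R by rewrite ltr0n.
have N1r : 1 <= N%:R :> R by rewrite ler1n.
have eps0 : 0 < eps by rewrite invr_gt0 mulr_gt0.
have eps1 : eps <= 1 by rewrite invf_le1 ?mulr_gt0//; lra.
have [_ [w [Ww w1] <-] hw] := sup_adherent (eps := t * eps) (E := E) ltac:(by rewrite mulr_gt0) hs.
have b := Bernoulli_le N (e := eps) ltac:(by rewrite eps1 ltW).
have Ne : N%:R * eps = 1 / 8 by rewrite /eps; field; rewrite gt_eqF.
rewrite Ne in b.
have : (t * (1 - eps)) ^+ N <= 3 / 4 * t ^+ N.
  apply: le_trans (hN _ Ww w1); rewrite lerXn2r ?nnegrE ?rnorm_ge0 ?mulr_ge0 ?subr_ge0 ?(ltW t0)//.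
  by apply: le_trans (ltW hw); rewrite mulrBr mulr1.
rewrite exprMn mulrC ler_pM2r ?exprn_gt0// => h; lra.
Qed.

End Complement.

(** Take a maximal orthonormal family of eigenvectors with eigenvalues of modulus
    at least [d]: on its orthogonal complement [T] has norm at most [d], so the
    remaining part of the trace of [T^n] is [O(d^n)]. *)
Theorem spectral_moments : exists (s : seq C) (K : R), [/\ all (fun a => a != 0) s, 0 <= K &
  forall n, (1 < n)%N -> normc (m1 n - \sum_(a <- s) a ^+ n) <= K * d ^+ n].
Proof.
have [||m [[u [mu hu]] hmax]] := exists_last (P := fun m => exists u mu, eigenfamily m u mu)
    (B := Num.bound (Re (m1 2) / d ^+ 2)).
- by exists (fun=> 0), (fun=> 0); split=> i.
- by move=> m [u [mu /eigenfamily_bound]].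
have hc := complement_norm hu (fun u' mu' h => hmax (ex_intro _ u' (ex_intro _ mu' h))).
have [e he eu] := basis_extension sH (proj1 hu).
have We i j : (m <= i)%N -> (j < m)%N -> '[e i, u j] = 0.
  move=> mi jm; rewrite -eu//; case: he => _ -> //.
  by rewrite gtn_eqF// (leq_trans jm).
have WT v : (forall j, (j < m)%N -> '[v, u j] = 0) -> forall j, (j < m)%N -> '[T v, u j] = 0.
  move=> hv i im; rewrite TT; have [-> _] := (proj2 hu) i im.
  by rewrite dotZr hv// mulr0.
have hk k v : (forall j, (j < m)%N -> '[v, u j] = 0) -> rnorm (iter k T v) <= d ^+ k * rnorm v.
  elim: k v => [|k IH] v hv; first by rewrite expr0 mul1r.
  rewrite iterSr; apply: le_trans (IH _ (WT _ hv)) _.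
  by rewrite exprSr -mulrA ler_pM2l ?exprn_gt0//; apply: hc.
exists (mkseq mu m), (Re (m1 2) / d ^+ 2); split.
- rewrite all_map; apply/allP => i; rewrite mem_iota => /= im.
  by rewrite -normc_gt0 (lt_le_trans d0)//; case: (proj2 hu i im).
- rewrite divr_ge0 ?sqr_ge0//; have := iter_moment_partial 0 he (n := 1) isT.
  by rewrite big_ord0.
move=> [//|[//|n]] _.
have := cplx_cvgD (hm1 (n := n.+2) isT he) (cplx_cvg_cst (- \sum_(a <- mkseq mu m) a ^+ n.+2)).
apply: cplx_cvg_le; exists m => M mM.
rewrite -(big_mkord xpredT (fun i => '[iter n.+2 T (e i), e i])).
rewrite (@big_cat_nat _ _ _ m)//= big_map.
rewrite (@eq_big_nat _ _ _ 0%N m _ (fun i => mu i ^+ n.+2)); last first.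
  move=> i /andP[_ im]; rewrite -[T (T _)]/(iter n.+2 T (e i)) eu//.
  rewrite (@iter_eigen _ (mu i)); last by case: (proj2 hu i im).
  by rewrite dotZl (proj1 hu)// eqxx mulr1.
rewrite /index_iota subn0 addrAC subrr add0r.
apply: le_trans (normc_sum _ _ _) _.
rewrite -mulrA (_ : (d ^+ 2)^-1 * d ^+ n.+2 = d ^+ n); last first.
  by rewrite -[n.+2]/(2 + n)%N exprD mulrA mulVf ?mul1r// expf_neq0// gt_eqF.
apply: (@le_trans _ _ (\sum_(m <= i < M) d ^+ n * rnorm (T (e i)) ^+ 2)).
  apply: ler_sum_nat => i /andP[mi _].
  have -> : '[T (T (iter n T (e i))), e i] = '[iter n T (T (e i)), T (e i)].
    by rewrite -TT -iterSr.
  apply: le_trans (CauchySchwarz_rnorm _ _) _; rewrite expr2 mulrA ler_wpM2r ?rnorm_ge0//.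
  by apply: hk; apply: WT => j jm; apply: We.
rewrite -mulr_sumr mulrC ler_wpM2r ?exprn_ge0 ?(ltW d0)//.
apply: le_trans (iter_moment_partial M he (n := 1) isT).
rewrite -(big_mkord xpredT (fun i => rnorm (iter 1 T (e i)) ^+ 2)).
rewrite [leRHS](@big_cat_nat _ _ _ m)//= lerDr sumr_ge0// => i _.
exact: sqr_ge0.
Qed.

End Spectral.

(** * Construction of the filtering polynomials *)

Section PolyNorm.
Variables (R : realType) (s : R).
Local Notation C := R[i].
Implicit Types p q : {poly C}.
Hypothesis s0 : 0 <= s.

(** A submultiplicative seminorm bounding [p] on the disc of radius [s]. *)
Definition coef_norm p : R := \sum_(i < size p) normc p`_i * s ^+ i.

Lemma coef_norm_widen n p : (size p <= n)%N -> coef_norm p = \sum_(i < n) normc p`_i * s ^+ i.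
Proof.
move=> h; rewrite /coef_norm (big_ord_widen n (fun i => normc p`_i * s ^+ i) h).
rewrite big_mkcond; apply: eq_bigr => i _; case: ltnP => //= /(nth_default 0) ->.
by rewrite normc0 mul0r.
Qed.

Lemma coef_norm_ge0 p : 0 <= coef_norm p.
Proof. by apply: sumr_ge0 => i _; rewrite mulr_ge0 ?normc_ge0 ?exprn_ge0. Qed.

Lemma coef_normD p q : coef_norm (p + q) <= coef_norm p + coef_norm q.
Proof.
pose n := maxn (size p) (size q).
rewrite !(@coef_norm_widen n) ?size_polyD ?leq_maxl ?leq_maxr// -big_split /=.
by apply: ler_sum => i _; rewrite coefD -mulrDl ler_wpM2r ?exprn_ge0// le_normcD.
Qed.

Lemma coef_normZ c p : coef_norm (c *: p) = normc c * coef_norm p.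
Proof.
rewrite !(@coef_norm_widen (size p)) ?size_scale_leq// mulr_sumr.
by apply: eq_bigr => i _; rewrite coefZ normcM mulrA.
Qed.

Lemma coef_normN p : coef_norm (- p) = coef_norm p.
Proof. by rewrite -scaleN1r coef_normZ normcN normc1 mul1r. Qed.

Lemma coef_normMX p : coef_norm (p * 'X) = s * coef_norm p.
Proof.
rewrite (@coef_norm_widen (size p).+1); last first.
  by apply: leq_trans (size_polyMleq _ _) _; rewrite size_polyX addnC.
rewrite big_ord_recl coefMX eqxx normc0 mul0r add0r /coef_norm mulr_sumr.
by apply: eq_bigr => i _; rewrite coefMX exprS mulrCA.
Qed.

Lemma coef_normDC p c : coef_norm (p * 'X + c%:P) = s * coef_norm p + normc c.
Proof.
rewrite (@coef_norm_widen (size p).+1); last first.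
  apply: leq_trans (size_polyD _ _) _; rewrite geq_max size_polyC.
  rewrite (leq_trans (leq_b1 _))// andbT.
  by apply: leq_trans (size_polyMleq _ _) _; rewrite size_polyX addnC.
rewrite big_ord_recl coefD coefMX coefC eqxx add0r expr0 mulr1 addrC; congr (_ + _).
rewrite /coef_norm mulr_sumr.
by apply: eq_bigr => i _; rewrite coefD coefMX coefC addr0 exprS mulrCA.
Qed.

Lemma coef_normM p q : coef_norm (p * q) <= coef_norm p * coef_norm q.
Proof.
elim/poly_ind: p => [|p c IH].
  by rewrite mul0r -(scale0r 0) coef_normZ normc0 mul0r mulr_ge0 ?coef_norm_ge0.
rewrite mulrDl -mulrA (mulrC 'X) mulrA mul_polyC.
apply: le_trans (coef_normD _ _) _; rewrite coef_normMX coef_normZ coef_normDC mulrDl -mulrA.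
by rewrite lerD2r ler_wpM2l.
Qed.

Lemma coef_norm1 : coef_norm 1 = 1.
Proof.
by rewrite -[1]/(1%:P) (@coef_norm_widen 1) ?size_polyC ?leq_b1// big_ord1 coefC normc1 mulr1.
Qed.

Lemma coef_normX p n : coef_norm (p ^+ n) <= coef_norm p ^+ n.
Proof.
elim: n => [|n IH]; first by rewrite !expr0 coef_norm1.
by rewrite !exprS (le_trans (coef_normM _ _))// ler_wpM2l ?coef_norm_ge0.
Qed.

Lemma coef_normMXn p n : coef_norm ('X^n * p) = s ^+ n * coef_norm p.
Proof.
elim: n => [|n IH]; first by rewrite !expr0 !mul1r.
by rewrite exprSr -mulrA (mulrC 'X) mulrA coef_normMX IH exprS mulrA.
Qed.

Lemma coef_norm_sum (I : Type) (r : seq I) (F : I -> {poly C}) :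
  coef_norm (\sum_(i <- r) F i) <= \sum_(i <- r) coef_norm (F i).
Proof.
elim: r => [|i r IH]; first by rewrite !big_nil -(scale0r 0) coef_normZ normc0 mul0r.
by rewrite !big_cons (le_trans (coef_normD _ _))// lerD2l.
Qed.

End PolyNorm.

Lemma geometric_small (R : realType) (A e : R) : 0 < e ->
  exists N, forall n, (N <= n)%N -> A / 2 ^+ n <= e.
Proof.
move=> e0; exists (Num.bound (A / e)) => n Nn.
have p2 : 0 < 2 ^+ n :> R by rewrite exprn_gt0.
rewrite ler_pdivrMr// mulrC -ler_pdivrMr//.
have [A0|A0] := leP (A / e) 0; first by rewrite (le_trans A0)// ltW.
apply: le_trans (ltW (archi_boundP (ltW A0))) _.
by rewrite -natrX ler_nat (leq_trans Nn)// ltnW// ltn_expl.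
Qed.

Lemma geometric_small2 (R : realType) (M A e : R) : 0 <= M -> 0 < e ->
  exists N, forall n x, (N <= n)%N -> 0 <= x <= A / 2 ^+ n -> M * x ^+ 2 <= e.
Proof.
move=> M0 e0; have [N hN] := geometric_small (M * A ^+ 2) e0.
exists N => n x Nn /andP[x0 hx]; apply: le_trans (hN n Nn).
rewrite -mulrA ler_wpM2l//.
have p2 : 1 <= 2 ^+ n :> R by rewrite exprn_ege1// ler1n.
have h : x ^+ 2 <= (A / 2 ^+ n) ^+ 2.
  by rewrite lerXn2r ?nnegrE// (le_trans x0).
have y0 : 0 <= (2 ^+ n)^-1 :> R by rewrite invr_ge0 (le_trans _ p2).
have y1 : (2 ^+ n)^-1 <= 1 :> R by rewrite invf_le1// (lt_le_trans _ p2).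
by apply: le_trans h _; rewrite exprMn ler_wpM2l ?sqr_ge0// expr2 ler_piMr.
Qed.

Definition product_count (R : realType) (s l : seq R[i]) (z : R[i]) : nat :=
  (\sum_(u <- s) \sum_(a <- l) (u * a == z)%R)%N.

Section FilterPolynomials.
Variable R : realType.
Local Notation C := R[i].
Implicit Types p q : {poly C}.
Variables (ma : nat -> C) (l : seq C) (phi : nat -> nat -> C).
Variables (m1 : nat -> C) (m2 : nat -> nat -> C) (B b : R).
Hypothesis b0 : 0 < b.
Hypothesis B0 : 0 <= B.
Hypothesis hm1 : forall n, m1 n.+2 = ma n.+2 * \sum_(a <- l) a ^+ n.+2.
Hypothesis hm2 : forall m n, m2 m.+1 n.+1 = ma (m + n).+2 * phi m n.
Hypothesis hphi : forall m q, \prod_(a <- l) ('X - a%:P) %| q ->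
  \sum_(n < size q) q`_n * phi m n = 0.
Hypothesis hphib : forall m n, normc (phi m n) <= B * b ^+ (m + n).
Hypothesis hlb : all (fun a => normc a <= b) l.

Variables (d K : R) (s : seq C).
Hypothesis d0 : 0 < d.
Hypothesis K0 : 0 <= K.
Hypothesis s_neq0 : all (fun a => a != 0) s.
Hypothesis hs : forall n, (1 < n)%N -> normc (ma n - \sum_(a <- s) a ^+ n) <= K * d ^+ n.

Let sg : R := d * b.
Let sg0 : 0 < sg. Proof. exact: mulr_gt0. Qed.
Let sgge0 : 0 <= sg. Proof. exact: ltW. Qed.

(** The characteristic polynomial of a matrix [u *: M] when [l] lists the
    eigenvalues of [M]. *)
Definition chi (u : C) : {poly C} := \prod_(a <- l) ('X - (u * a)%:P).

(** Substituting [u *: 'X] for ['X] turns [chi u] into a multiple of [chi 1]. *)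
Lemma chi_phi u m q : u != 0 -> chi u %| q ->
  \sum_(n < size q) q`_n * u ^+ n * phi m n = 0.
Proof.
move=> u0 /dvdpP[r ->].
pose q' := \poly_(n < size (r * chi u)) ((r * chi u)`_n * u ^+ n).
have e : q' = (r * chi u) \Po (u *: 'X).
  rewrite comp_polyE /q' poly_def; apply: eq_bigr => i _.
  by rewrite exprZn scalerA.
have dv : \prod_(a <- l) ('X - a%:P) %| q'.
  rewrite e comp_polyM dvdp_mull// /chi rmorph_prod /=.
  have -> : \prod_(a <- l) (('X - (u * a)%:P) \Po (u *: 'X)) =
      u ^+ size l *: \prod_(a <- l) ('X - a%:P).
    elim: l => [|a l' IH]; first by rewrite !big_nil scale1r.
    rewrite !big_cons IH exprS -scalerA -scalerAr; rewrite comp_polyB comp_polyX comp_polyC.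
    rewrite polyCM mul_polyC -scalerBr -scalerAl !scalerA.
    by congr (_ *: _); rewrite [LHS]mulrC.
  by rewrite dvdpZr ?expf_neq0.
have sq : (size q' <= size (r * chi u)%R)%N by exact: size_poly.
have := hphi m dv.
rewrite (big_ord_widen _ (fun n => q'`_n * phi m n) sq) big_mkcond /= => h0.
rewrite -[RHS]h0.
apply: eq_bigr => n _; case: ltnP => h; first by rewrite coef_poly ltn_ord.
have : q'`_n = 0 by rewrite nth_default.
by rewrite coef_poly ltn_ord => ->; rewrite mul0r.
Qed.

(** Replacing [ma n] by the power sum of the [u] in [s] gives [0], by [chi_phi];
    what remains is the error of that replacement.  The factor ['X] accounts for
    the shift of the indices in [hm2]. *)
Lemma hs_norm2_le p : (forall u, u \in s -> 'X * chi u %| p) -> p`_0 = 0 ->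
  hs_norm2 m2 p <= K * B / b ^+ 2 * (coef_norm sg p) ^+ 2.
Proof.
move=> hp p0; apply: le_trans (le_Re_normc _) _.
have [q pq] : exists q, p = q * 'X.
  have : 'X %| p by have := dvdp_XsubCl p 0; rewrite subr0 rootE horner_coef0 p0 eqxx => ->.
  by move=> /dvdpP[q ->]; exists q.
have szq : (size p <= (size q).+1)%N.
  by rewrite pq (leq_trans (size_polyMleq _ _))// size_polyX addnC.
have e1 : hs_form m2 p p = \sum_(i < size q) \sum_(j < size q)
    Num.conj q`_i * q`_j * (ma (i + j).+2 * phi i j).
  rewrite /hs_form.
  pose F i j := Num.conj p`_i * p`_j * m2 i j.
  have F0l j : F 0%N j = 0 by rewrite /F p0 conjC0 !mul0r.
  have F0r i : F i 0%N = 0 by rewrite /F p0 mulr0 !mul0r.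
  have wid (G : nat -> C) : (forall i, (size p <= i)%N -> G i = 0) ->
      \sum_(i < size p) G i = \sum_(i < (size q).+1) G i.
    move=> hG; rewrite (big_ord_widen _ G szq) big_mkcond; apply: eq_bigr => i _.
    by case: ltnP => // /hG.
  rewrite (wid (fun i => \sum_(j < size p) F i j)); last first.
    by move=> i hi; rewrite big1// => j _; rewrite /F (nth_default _ hi) conjC0 !mul0r.
  rewrite big_ord_recl big1 ?add0r => [|j _]; last exact: F0l.
  apply: eq_bigr => i _; rewrite (wid (F _)); last first.
    by move=> j hj; rewrite /F (nth_default _ hj) mulr0 mul0r.
  rewrite big_ord_recl F0r add0r; apply: eq_bigr => j _.
  by rewrite /F pq !coefMX hm2.
have e2 : hs_form m2 p p = \sum_(i < size q) \sum_(j < size q)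
    Num.conj q`_i * q`_j * ((ma (i + j).+2 - \sum_(u <- s) u ^+ (i + j).+2) * phi i j).
  rewrite e1; apply/eqP; rewrite -subr_eq0 -sumrB; apply/eqP.
  transitivity (\sum_(u <- s) \sum_(i < size q) Num.conj q`_i * u ^+ i * u ^+ 2 *
      \sum_(j < size q) (q`_j * u ^+ j * phi i j)).
    under [RHS]eq_bigr do under eq_bigr do rewrite mulr_sumr.
    under [RHS]eq_bigr do rewrite exchange_big.
    rewrite [RHS]exchange_big.
    under [RHS]eq_bigr do rewrite exchange_big.
    rewrite [RHS]exchange_big; apply: eq_bigr => i _.
    rewrite -sumrB; apply: eq_bigr => j _ /=.
    rewrite -mulrBr -mulrBl subKr mulr_suml mulr_sumr; apply: eq_bigr => u _.
    by rewrite -[(i + j).+2]addn2 !exprD; ring.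
  rewrite big_seq big1// => u us; rewrite big1// => i _.
  have u0 : u != 0 by exact: (allP s_neq0).
  rewrite chi_phi ?mulr0//; move: (hp u us); rewrite pq mulrC dvdp_mul2r//.
  by rewrite polyX_eq0.
have -> : K * B / b ^+ 2 * coef_norm sg p ^+ 2 = K * B * d ^+ 2 * coef_norm sg q ^+ 2.
  by rewrite pq coef_normMX /sg; field; rewrite gt_eqF.
rewrite e2; apply: le_trans (normc_sum _ _ _) _.
rewrite [X in _ * X]expr2 {1}/coef_norm mulr_suml mulr_sumr; apply: ler_sum => i _.
apply: le_trans (normc_sum _ _ _) _.
rewrite /coef_norm mulr_sumr mulr_sumr; apply: ler_sum => j _.
rewrite !normcM normc_conj.
have h1 := hs (n := (i + j).+2) isT; have h2 := hphib i j.
have -> : K * B * d ^+ 2 * (normc q`_i * sg ^+ i * (normc q`_j * sg ^+ j)) =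
   normc q`_i * normc q`_j * ((K * d ^+ (i + j).+2) * (B * b ^+ (i + j))).
  by rewrite /sg !exprMn -[(i + j).+2]addn2 !exprD; ring.
by rewrite ler_wpM2l ?mulr_ge0 ?normc_ge0// ler_pM ?normc_ge0.
Qed.

(** With the power sums of [s] in place of [ma], the trace of [p(x)] would be the
    sum of the values of [p] at the products [u * a]. *)
Lemma poly_trace_le p : 'X^2 %| p ->
  normc (poly_trace m1 p - \sum_(u <- s) \sum_(a <- l) p.[u * a]) <=
    K * (size l)%:R * coef_norm sg p.
Proof.
move=> /dvdpP[q pq].
have szq : (size p <= (size q).+2)%N.
  by rewrite pq (leq_trans (size_polyMleq _ _))// size_polyXn addnC.
have c0 : p`_0 = 0 by rewrite pq coefMXn.
have c1 : p`_1 = 0 by rewrite pq coefMXn.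
have c2 i : p`_(i.+2) = q`_i by rewrite pq coefMXn /= subn2.
have e1 : poly_trace m1 p = \sum_(i < size q) q`_i * m1 i.+2.
  rewrite /poly_trace (big_ord_widen _ (fun i => p`_i * m1 i) szq) big_mkcond.
  rewrite (eq_bigr (fun i : 'I__ => p`_i * m1 i)); last first.
    by move=> i _; case: ltnP => // /(nth_default 0) ->; rewrite mul0r.
  rewrite !big_ord_recl /= c0 c1 !mul0r !add0r.
  by apply: eq_bigr => i _; rewrite c2.
have e2 x : p.[x] = \sum_(i < size q) q`_i * x ^+ i.+2.
  rewrite pq hornerM hornerXn horner_coef mulr_suml; apply: eq_bigr => i _.
  by rewrite -mulrA -exprD addn2.
have e3 : poly_trace m1 p - \sum_(u <- s) \sum_(a <- l) p.[u * a] =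
   \sum_(i < size q) q`_i * ((ma i.+2 - \sum_(u <- s) u ^+ i.+2) * \sum_(a <- l) a ^+ i.+2).
  have -> : \sum_(u <- s) \sum_(a <- l) p.[u * a] =
     \sum_(i < size q) q`_i * ((\sum_(u <- s) u ^+ i.+2) * \sum_(a <- l) a ^+ i.+2).
    under eq_bigr do under eq_bigr do rewrite e2.
    under eq_bigr do rewrite exchange_big.
    rewrite exchange_big; apply: eq_bigr => i _.
    rewrite mulr_suml mulr_sumr; apply: eq_bigr => u _.
    rewrite !mulr_sumr; apply: eq_bigr => a _.
    by rewrite exprMn.
  rewrite e1 -sumrB; apply: eq_bigr => i _; rewrite hm1 -mulrBr mulrBl //.
rewrite e3; apply: le_trans (normc_sum _ _ _) _.
rewrite pq (mulrC q) coef_normMXn.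
rewrite /coef_norm !mulr_sumr; apply: ler_sum => i _.
rewrite !normcM.
have h1 := hs (n := i.+2) isT.
have h2 : normc (\sum_(a <- l) a ^+ i.+2) <= (size l)%:R * b ^+ i.+2.
  apply: le_trans (normc_sum _ _ _) _.
  elim: l hlb => [|a l' IH] /=; first by rewrite big_nil mul0r.
  move=> /andP[ha /IH h]; rewrite big_cons -natr1 mulrDl mul1r addrC lerD//.
  by rewrite normcX lerXn2r ?nnegrE ?normc_ge0 ?(ltW b0).
have -> : K * (size l)%:R * (sg ^+ 2 * (normc q`_i * sg ^+ i)) =
   normc q`_i * ((K * d ^+ i.+2) * ((size l)%:R * b ^+ i.+2)).
  by rewrite /sg !exprMn !exprS; ring.
by rewrite ler_wpM2l ?normc_ge0// ler_pM ?normc_ge0.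
Qed.

Variables (z : C) (r : nat).
Hypothesis z0 : z != 0.
Hypothesis hz : sg * 2 <= normc z.

Let k := size l.
(* The order must be positive for [f n] to take the value [1] at [z], at least
   [size l] so that [chi u] divides [f n - f m], and at least [r]. *)
Let r' := (r + k).+1.
Let Q : {poly C} := \prod_(u <- s) \prod_(a <- l | u * a != z) ('X - (u * a)%:P).
(* [g n] is [1] at [z], vanishes at the other products [u * a], and the factor
   ['X^(n.+1)] makes it decay near the origin. *)
Let g n : {poly C} := (z ^+ n.+1 * Q.[z])^-1 *: ('X^(n.+1) * Q).
(* The shape [1 - (1 - g) ^+ r'] keeps the zeros of [g] and improves the equality
   [g.[z] = 1] to a congruence modulo [('X - z) ^+ r']. *)
Let f n : {poly C} := 1 - (1 - g n) ^+ r'.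

Let Qz : Q.[z] != 0.
Proof.
rewrite /Q horner_prod prodf_seq_neq0; apply/allP => u _ /=.
rewrite horner_prod prodf_seq_neq0; apply/allP => a _ /=.
by apply/implyP; rewrite hornerXsubC subr_eq0 eq_sym.
Qed.

Let gz n : (g n).[z] = 1.
Proof.
by rewrite /g hornerZ hornerM hornerXn mulVf// mulf_neq0// expf_neq0.
Qed.

Let XQg n : 'X * Q %| g n.
Proof. by rewrite /g dvdpZr ?invr_eq0 ?mulf_neq0 ?expf_neq0// dvdp_mul// exprS dvdp_mulr. Qed.

Let f_factor n : f n = g n * \sum_(i < r') (1 - g n) ^+ i.
Proof.
by rewrite /f -opprB subrX1 -mulNr opprB opprD opprK addrA subrr add0r.
Qed.

Let XQf n : 'X * Q %| f n.
Proof. by rewrite f_factor dvdp_mulr. Qed.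

Let f_1 n : ('X - z%:P) ^+ r' %| 1 - f n.
Proof.
have h1 : (1 : {poly C}).[z] = 1 by rewrite hornerE.
by rewrite /f subKr dvdp_exp2r// dvdp_XsubCl rootE hornerD hornerN gz h1 subrr.
Qed.

Let chi_dvd u : u \in s -> chi u %| Q * ('X - z%:P) ^+ k.
Proof.
move=> us; rewrite /chi (bigID (fun a => u * a != z)) /=; apply: dvdp_mul.
  by rewrite /Q [X in _ %| X](big_rem u)//= dvdp_mulr.
rewrite (eq_bigr (fun=> 'X - z%:P)); last by move=> a; rewrite negbK => /eqP ->.
by rewrite big_const_seq iter_mulr_1 dvdp_exp2l// count_size.
Qed.

(* [f n] and [f m] are [1] modulo [('X - z) ^+ r'], so their difference is
   divisible by the coprime polynomials ['X * Q] and [('X - z) ^+ r']. *)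
Let f_C n m u : u \in s -> 'X * chi u %| f n - f m.
Proof.
move=> us; apply: (@dvdp_trans _ ('X * Q * ('X - z%:P) ^+ r')).
  rewrite -mulrA dvdp_mul2l ?polyX_eq0//; apply: dvdp_trans (chi_dvd us) _.
  by rewrite dvdp_mul// dvdp_exp2l// /r' leqW// leq_addl.
rewrite Gauss_dvdp; last first.
  by rewrite coprimep_expr// coprimep_XsubC rootE hornerM hornerX mulf_neq0.
apply/andP; split; first by rewrite dvdp_sub.
have -> : f n - f m = (1 - f m) - (1 - f n) by ring.
by rewrite dvdp_sub.
Qed.

Let f_k n u : u \in s -> 'X * chi u %| ('X - z%:P) ^+ k * f n.
Proof.
move=> us; rewrite [_ * f n]mulrC; apply: dvdp_trans (dvdp_mul (XQf n) (dvdpp _)).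
by rewrite -mulrA dvdp_mul2l ?polyX_eq0// chi_dvd.
Qed.

Let f0 n : (f n)`_0 = 0.
Proof.
have /dvdpP[p ->] := XQf n.
by rewrite mulrCA mulrC coefMX.
Qed.

Let f_eval n u a : u \in s -> a \in l -> (f n).[u * a] = (u * a == z)%:R.
Proof.
move=> us al; have [->|ne] := eqVneq (u * a) z.
  have h1 : (1 : {poly C}).[z] = 1 by rewrite hornerE.
  by rewrite /f hornerD hornerN horner_exp hornerD hornerN gz h1 subrr exprS mul0r subr0.
have /dvdpP[p ->] := XQf n.
rewrite !hornerM; suff -> : Q.[u * a] = 0 by rewrite !mulr0.
rewrite /Q horner_prod (big_rem u)//= horner_prod (big_rem a)//= ne hornerXsubC subrr.
by rewrite !mul0r.
Qed.

Let G := coef_norm sg Q / normc Q.[z].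
Let D := G * (r'%:R * (1 + G) ^+ r').

Let G0 : 0 <= G.
Proof. by rewrite divr_ge0 ?coef_norm_ge0 ?normc_ge0. Qed.

Let coef_norm_g n : coef_norm sg (g n) <= G / 2 ^+ n.
Proof.
have zp : 0 < normc z by rewrite normc_gt0.
have Qp : 0 < normc Q.[z] by rewrite normc_gt0.
rewrite /g coef_normZ coef_normMXn normcV normcM normcX.
have -> : (normc z ^+ n.+1 * normc Q.[z])^-1 * (sg ^+ n.+1 * coef_norm sg Q) =
    G * (sg / normc z) ^+ n.+1.
  rewrite /G expr_div_n; have : normc z ^+ n.+1 != 0 by rewrite expf_neq0// gt_eqF.
  by move: (normc z ^+ n.+1) (sg ^+ n.+1) => x y x0; field; rewrite x0 gt_eqF.
rewrite ler_wpM2l// -exprVn.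
have h : sg / normc z <= 2^-1.
  by rewrite ler_pdivrMr// mulrC ler_pdivlMr.
apply: (@le_trans _ _ (2^-1 ^+ n.+1)).
  by rewrite lerXn2r ?nnegrE ?divr_ge0 ?invr_ge0 ?(ltW zp).
rewrite exprS ler_piMl ?exprn_ge0 ?invr_ge0//; lra.
Qed.

Let coef_norm_f n : coef_norm sg (f n) <= D / 2 ^+ n.
Proof.
rewrite f_factor; apply: le_trans (coef_normM sgge0 _ _) _.
rewrite /D mulrAC; apply: ler_pM => //; [exact: coef_norm_ge0|exact: coef_norm_ge0|].
apply: le_trans (coef_norm_sum sgge0 _ _) _.
have p2 : 1 <= 2 ^+ n :> R by rewrite exprn_ege1// ler1n.
have gG : coef_norm sg (g n) <= G.
  apply: le_trans (coef_norm_g n) _; rewrite ler_pdivrMr ?(lt_le_trans ltr01)//.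
  by rewrite ler_peMr.
rewrite mulr_natl -[X in _ *+ X](card_ord r') -sumr_const; apply: ler_sum => i _.
apply: le_trans (coef_normX sgge0 _ _) _.
apply: (@le_trans _ _ ((1 + G) ^+ i)).
  rewrite lerXn2r ?nnegrE ?coef_norm_ge0 ?addr_ge0//.
  by apply: le_trans (coef_normD sgge0 _ _) _; rewrite coef_normN coef_norm1 lerD2l.
by rewrite ler_weXn2l ?lerDl// ltnW.
Qed.

Let M0 : 0 <= K * B / b ^+ 2.
Proof. by rewrite !mulr_ge0// invr_ge0 sqr_ge0. Qed.

(** All the quantities to be estimated are polynomials to which [hs_norm2_le] or
    [poly_trace_le] applies, and their coefficient norms are [O(2^-n)] because
    [d * b] is at most half the modulus of [z]. *)
Theorem filter_polynomials : exists h : nat -> {poly C}, [/\ forall n, (h n)`_0 = 0,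
    forall n, ('X - z%:P) ^+ r %| 1 - h n,
    forall e : R, 0 < e -> exists N, forall n m, (N <= n)%N -> (N <= m)%N ->
      hs_norm2 m2 (h n - h m) <= e,
    forall e : R, 0 < e -> exists N, forall n, (N <= n)%N ->
      hs_norm2 m2 (('X - z%:P) ^+ size l * h n) <= e &
    cplx_cvg (fun n => poly_trace m1 (h 0%N * h n)) (product_count s l z)%:R].
Proof.
exists f; split.
- exact: f0.
- by move=> n; apply: dvdp_trans (f_1 n); rewrite dvdp_exp2l// /r' leqW// leq_addr.
- move=> e e0; have [N hN] := geometric_small2 (2 * D) M0 e0.
  exists N => n m Nn Nm.
  apply: le_trans (hs_norm2_le _ _) _; first by move=> u us; apply: f_C.
    by rewrite coefB !f0 subrr.
  apply: (hN N) => //; rewrite coef_norm_ge0//=.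
  apply: le_trans (coef_normD sgge0 _ _) _; rewrite coef_normN -mulrA mulr_natl mulr2n.
  have hp i : (N <= i)%N -> coef_norm sg (f i) <= D / 2 ^+ N.
    move=> Ni; apply: le_trans (coef_norm_f i) _; rewrite ler_wpM2l//.
      by rewrite /D mulr_ge0// mulr_ge0// exprn_ge0// addr_ge0.
    by rewrite lef_pV2 ?posrE ?exprn_gt0// ler_weXn2l// ler1n.
  by rewrite lerD ?hp.
- move=> e e0; pose P := coef_norm sg (('X - z%:P) ^+ k).
  have [N hN] := geometric_small2 (P * D) M0 e0.
  exists N => n Nn.
  apply: le_trans (hs_norm2_le _ _) _; first by move=> u us; apply: f_k.
    by rewrite coef0M f0 mulr0.
  apply: (hN n) => //; rewrite coef_norm_ge0//=.
  apply: le_trans (coef_normM sgge0 _ _) _; rewrite -mulrA ler_wpM2l ?coef_norm_ge0//.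
move=> e e0.
have [N hN] := geometric_small (K * (size l)%:R * coef_norm sg (f 0%N) * D) e0.
exists N => n Nn; apply: le_trans (hN n Nn).
have -> : (product_count s l z)%:R =
    \sum_(u <- s) \sum_(a <- l) (f 0%N * f n).[u * a].
  rewrite natr_sum; apply: eq_big_seq => u us.
  rewrite natr_sum; apply: eq_big_seq => a al.
  by rewrite hornerM !f_eval// -natrM mulnb andbb.
apply: le_trans (poly_trace_le _) _.
  have hX i : 'X %| f i by apply: dvdp_trans (XQf i); rewrite dvdp_mulr.
  by rewrite expr2 dvdp_mul.
have KL : 0 <= K * (size l)%:R by rewrite mulr_ge0.
have -> : K * (size l)%:R * coef_norm sg (f 0%N) * D / 2 ^+ n =
    K * (size l)%:R * (coef_norm sg (f 0%N) * (D / 2 ^+ n)) by rewrite !mulrA.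
apply: (ler_wpM2l KL).
by apply: le_trans (coef_normM sgge0 _ _) _; apply: ler_wpM2l (coef_norm_f n); exact: coef_norm_ge0.
Qed.

End FilterPolynomials.

(** * Traces of powers of a matrix *)

Section PowerTrace.
Variable R : realType.
Local Notation C := R[i].

Lemma trig_pow k (T : 'M[C]_k.+1) n : is_trig_mx T ->
  is_trig_mx (T ^+ n) /\ forall i, (T ^+ n) i i = T i i ^+ n.
Proof.
move=> hT; have /is_trig_mxP hT' := hT; elim: n => [|n [/is_trig_mxP IH1 IH2]].
  split=> [|i]; last by rewrite !expr0 mxE eqxx.
  by apply/is_trig_mxP => i j ij; rewrite expr0 mxE -val_eqE ltn_eqF.
split=> [|i].
  apply/is_trig_mxP => i j ij; rewrite exprS mxE big1// => m _.
  case: (ltnP i m) => im; first by rewrite hT' ?mul0r.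
  by rewrite IH1 ?mulr0// (leq_ltn_trans im).
rewrite exprS mxE (bigD1 i)//= big1 => [|m mi]; first by rewrite IH2 addr0 exprS.
case: (ltngtP i m) => im; first by rewrite hT' ?mul0r.
  by rewrite IH1 ?mulr0.
by move: mi; rewrite -val_eqE /= im eqxx.
Qed.

Lemma char_poly_conj k (M P : 'M[C]_k) : P \in unitmx ->
  char_poly (P *m M *m invmx P) = char_poly M.
Proof.
move=> Pu; rewrite /char_poly /char_poly_mx.
have hI : map_mx polyC P *m map_mx polyC (invmx P) = 1%:M.
  by rewrite -map_mxM mulmxV// map_mx1.
have -> : 'X%:M - map_mx polyC (P *m M *m invmx P) =
   map_mx polyC P *m ('X%:M - map_mx polyC M) *m map_mx polyC (invmx P).
  by rewrite mulmxBr mulmxBl !map_mxM scalar_mxC -(mulmxA _ (map_mx polyC P)) hI mulmx1.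
by rewrite !det_mulmx mulrAC -det_mulmx hI det1 mul1r.
Qed.

(** By Schur's theorem the matrix may be taken triangular, and the diagonal is
    then a permutation of [lambda]. *)
Lemma mxtrace_pow_eigen k (M : 'M[C]_k.+1) (lambda : 'I_k.+1 -> C) n :
  char_poly M = \prod_i ('X - (lambda i)%:P) ->
  \tr (M ^+ n) = \sum_i lambda i ^+ n.
Proof.
move=> hM; have [P /unitarymx_unit Pu] := Schur M (ltn0Sn k).
rewrite /similar_to conjumx// => hT.
pose T : 'M[C]_k.+1 := P *m M *m invmx P.
have hp : perm_eq [seq T i i | i <- index_enum 'I_k.+1] [seq lambda i | i <- index_enum 'I_k.+1].
  apply: prod_XsubC_eq; rewrite !big_map -hM -(char_poly_conj M Pu).
  by rewrite (char_poly_trig hT).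
have -> : \tr (M ^+ n) = \tr (T ^+ n).
  have -> : T ^+ n = P *m (M ^+ n) *m invmx P.
    elim: n => [|n IH]; first by rewrite !expr0 mulmx1 mulmxV.
    by rewrite !exprS IH -!mulmxE /T !mulmxA mulmxKV.
  by rewrite -mulmxA mxtrace_mulC mulmxKV.
rewrite /mxtrace (eq_bigr (fun i => T i i ^+ n)) => [|i _]; last first.
  by case: (trig_pow n hT).
by rewrite -(big_map (fun i => T i i) xpredT (fun x => x ^+ n)) (perm_big _ hp) big_map.
Qed.

End PowerTrace.

(** * Cyclically monotone words *)

Section Letters.
Variables (R : realType) (A : starAlgType R) (w : tracial_weight A).
Local Notation C := R[i].

Lemma weight0 : w 0 = 0.
Proof.
have D0 : weight_dom w 0 by case: (weight_dom_alg w) => -[].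
by have := weightZ 0 D0; rewrite scale0r mul0r.
Qed.

Lemma weight_dom0 : weight_dom w 0.
Proof. by case: (weight_dom_alg w) => -[]. Qed.
Lemma weight_domD x y : weight_dom w x -> weight_dom w y -> weight_dom w (x + y).
Proof. by case: (weight_dom_alg w) => -[_ h _] _ _; apply: h. Qed.
Lemma weight_domZ (z : C) x : weight_dom w x -> weight_dom w (z *: x).
Proof. by case: (weight_dom_alg w) => -[_ _ h] _ _; apply: h. Qed.
Lemma weight_domM x y : weight_dom w x -> weight_dom w y -> weight_dom w (x * y).
Proof. by case: (weight_dom_alg w) => _ h _; apply: h. Qed.
Lemma weight_dom_star x : weight_dom w x -> weight_dom w (star x).
Proof. by case: (weight_dom_alg w) => _ _ h; apply: h. Qed.
Lemma weight_dom_sum (I : Type) (r : seq I) (F : I -> A) :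
  (forall i, weight_dom w (F i)) -> weight_dom w (\sum_(i <- r) F i).
Proof.
move=> h; elim: r => [|i r IH]; first by rewrite big_nil; exact: weight_dom0.
by rewrite big_cons; apply: weight_domD.
Qed.

Lemma weight_sum (I : Type) (r : seq I) (F : I -> A) :
  (forall i, weight_dom w (F i)) -> w (\sum_(i <- r) F i) = \sum_(i <- r) w (F i).
Proof.
move=> h; elim: r => [|i r IH]; first by rewrite !big_nil weight0.
by rewrite !big_cons weightD// ?IH//; exact: weight_dom_sum.
Qed.

Lemma smallest_star_subalgebra (X : set A) : star_subalgebra (star_alg X).
Proof.
split; first split.
- by move=> M [[[]]].
- by move=> x y hx hy M hM; case: (hM) => -[[_ h _] _ _] _; apply: h; [apply: hx|apply: hy].
- by move=> z x hx M hM; case: (hM) => -[[_ _ h] _ _] _; apply: h; apply: hx.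
- by move=> x y hx hy M hM; case: (hM) => -[_ h _] _; apply: h; [apply: hx|apply: hy].
- by move=> x hx M hM; case: (hM) => -[_ _ h] _; apply: h; apply: hx.
Qed.

Lemma sub_star_alg (X : set A) : X `<=` star_alg X.
Proof. by move=> x Xx M [_]; apply. Qed.

Variables (tau : {scalar A}) (k : nat) (a : A) (b c : 'I_k -> A).
Hypothesis mono : cyclically_monotone w tau [set a] (range b `|` range c).

Let B := star_alg ([set 1] `|` (range b `|` range c)).
Let Bst : star_subalgebra B := smallest_star_subalgebra _.

Let B1 : B 1. Proof. by apply: sub_star_alg; left. Qed.
Let Bb i : B (b i). Proof. by apply: sub_star_alg; right; left; exists i. Qed.
Let Bc i : B (c i). Proof. by apply: sub_star_alg; right; right; exists i. Qed.
Let BM x y : B x -> B y -> B (x * y). Proof. exact: star_subalgebraM. Qed.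

(* The domain of [w] need not absorb multiplication by [B]; the elements of [J]
   can be multiplied freely by [B] on both sides without leaving it. *)
Let J (y : A) := forall u v, B u -> B v -> weight_dom w (u * y * v).

Let J_a : J a.
Proof.
move=> u v Bu Bv; case: mono => h _; apply: h => M [_]; apply.
exists 0%N, u, (fun=> a), (fun=> v); split=> //.
  by move=> _; apply: sub_star_alg.
by rewrite big_ord1 mulrA.
Qed.
Let J_B u v y : B u -> B v -> J y -> J (u * y * v).
Proof. by move=> Bu Bv Jy u' v' Bu' Bv'; rewrite !mulrA -mulrA; apply: Jy; apply: BM. Qed.
Let J_l u y : B u -> J y -> J (u * y).
Proof. by move=> Bu Jy; rewrite -[u * y]mulr1; apply: J_B. Qed.
Let J_r v y : B v -> J y -> J (y * v).
Proof. by move=> Bv Jy; rewrite -[y]mul1r; apply: J_B. Qed.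
Let J_M x y : J x -> J y -> J (x * y).
Proof.
move=> Jx Jy u v Bu Bv.
have -> : u * (x * y) * v = (u * x * 1) * (1 * y * v) by rewrite mulr1 mul1r !mulrA.
by apply: weight_domM; [apply: Jx|apply: Jy].
Qed.
Let J_sum (I : Type) (r : seq I) (F : I -> A) : (forall i, J (F i)) -> J (\sum_(i <- r) F i).
Proof.
move=> h u v Bu Bv; rewrite mulr_sumr mulr_suml.
by apply: weight_dom_sum => i; apply: h.
Qed.
Let J_dom y : J y -> weight_dom w y.
Proof. by move=> /(_ 1 1 B1 B1); rewrite mul1r mulr1. Qed.

Let Z (l : seq A) := \prod_(u <- l) (a * u).

Let Z_J l : l != [::] -> (forall i, B (nth 1 l i)) -> J (Z l).
Proof.
elim: l => [//|u l IH] _ h; rewrite /Z big_cons.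
have Bu : B u := h 0%N.
have [->|l0] := eqVneq l [::]; first by rewrite big_nil mulr1; apply: J_r.
apply: J_M; first exact: J_r.
by apply: IH => // i; have := h i.+1.
Qed.

(* Cyclic monotonicity for words in the single element [a]. *)
Let Z_weight l : l != [::] -> (forall i, B (nth 1 l i)) ->
  w (Z l) = w (a ^+ size l) * \prod_(u <- l) tau u.
Proof.
case: mono => _ h l0 hl.
have := h (size l).-1 (fun=> a) (fun i => nth 1 l i) _ (fun i => hl i).
move=> /(_ (fun=> sub_star_alg (erefl a))).
rewrite prednK; last by rewrite lt0n size_eq0.
have -> : Z l = \prod_(i < size l) (a * nth 1 l i) by rewrite /Z (big_nth 1) big_mkord.
have -> : \prod_(u <- l) tau u = \prod_(i < size l) tau (nth 1 l i).
  by rewrite (big_nth 1) big_mkord.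
by rewrite prodr_const card_ord.
Qed.

(** [letter false] is the sum of the [b i * a * c i] and [letter true] is its
    adjoint when [a], [b] and [c] are selfadjoint. *)
Definition lft (x : bool) i := if x then c i else b i.
Definition letter (x : bool) : A := \sum_i lft x i * a * lft (~~ x) i.

Let B_lft x i : B (lft x i).
Proof. by case: x. Qed.

Definition word (t : seq bool) : A := \prod_(x <- t) letter x.

(** The factor contributed by [tau] to a word of letters placed between [u] and
    [v]. *)
Fixpoint kappa (t : seq bool) (u v : A) : C :=
  if t is x :: t' then \sum_i tau (u * lft x i) * kappa t' (lft (~~ x) i) v
  else tau (u * v).

Let J_letter x : J (letter x).
Proof. by apply: J_sum => i; apply: J_B. Qed.

Let J_word t y : J y -> J (y * word t).
Proof.
rewrite /word; elim: t y => [|x t IH] y Jy; first by rewrite big_nil mulr1.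
by rewrite big_cons mulrA; apply: IH; apply: J_M.
Qed.

(** The accumulator [l] collects the elements of [B] met so far, each preceded by
    an [a]; expanding one letter moves one more of them into [l]. *)
Lemma weight_word l t u v : (forall i, B (nth 1 l i)) -> B u -> B v ->
  w (Z l * (a * u) * word t * v) =
    w (a ^+ (size l + size t).+1) * \prod_(y <- l) tau y * kappa t u v.
Proof.
elim: t l u => [|x t IH] l u hl Bu Bv.
  have -> : Z l * (a * u) * word [::] * v = Z (rcons l (u * v)).
    by rewrite /word big_nil /Z mulr1 big_rcons /= !mulrA.
  rewrite Z_weight; last first.
    - move=> i; rewrite nth_rcons; case: ifP => // _; case: ifP => // _; exact: BM.
    - by case: (l).
  rewrite size_rcons addn0 big_rcons /= -mulrA //.
have -> : Z l * (a * u) * word (x :: t) * v =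
    \sum_i Z (rcons l (u * lft x i)) * (a * lft (~~ x) i) * word t * v.
  rewrite /word big_cons /letter mulr_suml mulr_sumr mulr_suml; apply: eq_bigr => i _.
  by rewrite /Z big_rcons /= !mulrA.
have hl' i j : B (nth 1 (rcons l (u * lft x i)) j).
  by rewrite nth_rcons; case: ifP => // _; case: ifP => // _; exact: BM.
rewrite weight_sum => [|i]; last first.
  apply: J_dom; apply: J_r => //; apply: J_word; apply: J_M.
    by apply: Z_J => //; case: (l).
  exact: J_r.
rewrite /= mulr_sumr; apply: eq_bigr => i _.
rewrite IH// size_rcons big_rcons /= addSnnS.
by rewrite -!mulrA.
Qed.

(** Both uses of traciality are between elements of the domain: [b_i a] and the
    rest of the word, then [a] and the rest. *)
Lemma weight_letter_word x t : t != [::] ->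
  w (letter x * word t) =
    w (a ^+ (size t).+1) * \sum_i kappa t (lft (~~ x) i) (lft x i).
Proof.
move=> t0.
have Jt : J (word t).
  case: t t0 => [//|y t _]; rewrite /word big_cons; exact: J_word.
rewrite /letter mulr_suml weight_sum => [|i]; last first.
  by apply: J_dom; apply: J_M => //; apply: J_B.
rewrite mulr_sumr; apply: eq_bigr => i _.
rewrite -!mulrA mulrA weightC; last 2 first.
- by apply: J_dom; apply: J_l.
- by apply: J_dom; apply: J_l.
rewrite mulrA weightC; last 2 first.
- by apply: J_dom; apply/J_r/J_l.
- exact: J_dom.
have := @weight_word [::] t (lft (~~ x) i) (lft x i).
rewrite /Z !big_nil mul1r mulr1 add0n !mulrA => -> // j.
by rewrite nth_nil.
Qed.

End Letters.

(** * The moments of the sum and of the scaled element *)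

Section Kappa.
Variables (R : realType) (A : starAlgType R).
Local Notation C := R[i].

Section NonEmpty.
Variables (tau : {scalar A}) (k : nat) (b c : 'I_k.+1 -> A).
Local Notation M := (\matrix_(i < k.+1, j < k.+1) tau (c i * b j) : 'M[C]_k.+1).
Local Notation kappa := (kappa tau b c).

Lemma kappa_false n u v : kappa (nseq n.+1 false) u v =
  \sum_i tau (u * b i) * \sum_j (M ^+ n) i j * tau (c j * v).
Proof.
elim: n u => [|n IH] u.
  rewrite /=; apply: eq_bigr => i _; rewrite expr0 (bigD1 i)//= big1.
    by rewrite mxE eqxx mul1r addr0.
  by move=> j ji; rewrite mxE eq_sym (negbTE ji) mul0r.
rewrite [LHS]/=; apply: eq_bigr => i _; congr (_ * _).
rewrite -[LHS]/(kappa (nseq n.+1 false) (c i) v) IH.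
under [RHS]eq_bigr do rewrite exprS mxE mulr_suml.
rewrite exchange_big; apply: eq_bigr => j _ /=.
by rewrite mulr_sumr; apply: eq_bigr => m _; rewrite !mxE mulrA.
Qed.

Lemma kappa_trace n : \sum_i kappa (nseq n.+1 false) (c i) (b i) = \tr (M ^+ n.+2).
Proof.
rewrite exprSr exprS /mxtrace; apply: eq_bigr => i _.
rewrite kappa_false !mxE.
under [RHS]eq_bigr do rewrite mxE mulr_suml.
rewrite exchange_big; apply: eq_bigr => j _ /=.
by rewrite mulr_sumr; apply: eq_bigr => m _; rewrite !mxE mulrA.
Qed.

Lemma horner_mx_coef q : horner_mx M q = \sum_(n < size q) q`_n *: M ^+ n.
Proof.
rewrite -{1}[q]coefK poly_def rmorph_sum; apply: eq_bigr => n _.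
by rewrite /= linearZ rmorphXn /= horner_mx_X.
Qed.

(** [kappa] is linear in the power [M ^+ n], so Cayley-Hamilton applies. *)
Lemma kappa_annihilated m q u v : char_poly M %| q ->
  \sum_(n < size q) q`_n * kappa (nseq m true ++ nseq n.+1 false) u v = 0.
Proof.
move=> hq; elim: m u => [|m IH] u.
  have q0 : horner_mx M q = 0.
    have /dvdpP[r ->] := hq.
    by rewrite rmorphM /= Cayley_Hamilton mulr0.
  under eq_bigr do rewrite [nseq 0 true ++ _]/(nseq _.+1 false) kappa_false mulr_sumr.
  rewrite exchange_big big1// => i _ /=.
  under eq_bigr do rewrite mulrCA mulr_sumr.
  rewrite -mulr_sumr exchange_big big1 ?mulr0// => j _ /=.
  under eq_bigr do rewrite mulrA.
  rewrite -mulr_suml; suff -> : \sum_(n < size q) q`_n * (M ^+ n) i j = 0 by rewrite mul0r.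
  move: q0; rewrite horner_mx_coef => /matrixP/(_ i j).
  rewrite summxE [RHS]mxE => h; rewrite -[RHS]h.
  by apply: eq_bigr => n _; rewrite [RHS]mxE.
rewrite /=.
under eq_bigr do rewrite mulr_sumr.
rewrite exchange_big big1// => i _ /=.
under eq_bigr do rewrite mulrCA.
by rewrite -mulr_sumr IH mulr0.
Qed.

End NonEmpty.

Variables (tau : {scalar A}) (k : nat) (b c : 'I_k -> A).
Local Notation lft := (lft b c).

Definition kappa_const : R :=
  \sum_(p : bool * bool * 'I_k * 'I_k) normc (tau (lft p.1.1.1 p.1.2 * lft p.1.1.2 p.2)).

Lemma kappa_const_ge x y i j : normc (tau (lft x i * lft y j)) <= kappa_const.
Proof.
rewrite /kappa_const (bigD1 (x, y, i, j))//= lerDl.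
by apply: sumr_ge0 => p _; exact: normc_ge0.
Qed.

Lemma kappa_const_ge0 : 0 <= kappa_const.
Proof. by apply: sumr_ge0 => p _; exact: normc_ge0. Qed.

Lemma kappa_bound t x y i j : normc (kappa tau b c t (lft x i) (lft y j)) <=
  kappa_const * (k%:R * kappa_const) ^+ size t.
Proof.
elim: t x i => [|z t IH] x i; first by rewrite expr0 mulr1 kappa_const_ge.
rewrite /=; apply: le_trans (normc_sum _ _ _) _.
apply: (@le_trans _ _ (\sum_(m < k) kappa_const * (kappa_const * (k%:R * kappa_const) ^+ size t))).
  by apply: ler_sum => m _; rewrite normcM ler_pM ?normc_ge0 ?kappa_const_ge.
rewrite sumr_const card_ord -mulr_natl exprS.
by rewrite le_eqVlt; apply/orP; left; apply/eqP; ring.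
Qed.

End Kappa.

Section Models.
Variables (R : realType) (A : starAlgType R) (w : tracial_weight A).
Local Notation C := R[i].

(** What the multiplicity computation needs to know about [Y]: its power sums,
    its mixed moments, the relation coming from the characteristic polynomial of
    the matrix with eigenvalues [l], and a geometric bound. *)
Definition moment_model (ma : nat -> C) (Y : A) (l : seq C) (b : R) : Prop :=
  exists (B : R) (phi : nat -> nat -> C), [/\ 0 <= B,
    forall n, w (Y ^+ n.+2) = ma n.+2 * \sum_(a <- l) a ^+ n.+2,
    forall m n, w (star Y ^+ m.+1 * Y ^+ n.+1) = ma (m + n).+2 * phi m n,
    forall m (q : {poly C}), \prod_(a <- l) ('X - a%:P) %| q ->
      \sum_(n < size q) q`_n * phi m n = 0 &
    forall m n, normc (phi m n) <= B * b ^+ (m + n)].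

Lemma star_sum (I : Type) (r : seq I) (F : I -> A) :
  star (\sum_(i <- r) F i) = \sum_(i <- r) star (F i).
Proof.
apply: (big_morph _ (@starD R A)).
by have := starZ 0 (0 : A); rewrite !scale0r conjC0 scale0r.
Qed.

Variables (tau : {scalar A}) (a : A).
Hypothesis a_sa : selfadjoint a.

Lemma word_nseq k (b c : 'I_k -> A) x n : word a b c (nseq n x) = letter a b c x ^+ n.
Proof.
elim: n => [|n IH]; first by rewrite /word big_nil.
by rewrite /= /word big_cons -/(word a b c _) IH exprS.
Qed.

Lemma letter_word_model k (b c : 'I_k -> A) (lambda : 'I_k -> C) beta :
  cyclically_monotone w tau [set a] (range b `|` range c) ->
  (forall i, selfadjoint (b i)) -> (forall i, selfadjoint (c i)) ->
  char_poly (\matrix_(i < k, j < k) tau (c i * b j)) = \prod_(i < k) ('X - (lambda i)%:P) ->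
  k%:R * kappa_const tau b c <= beta ->
  moment_model (fun n => w (a ^+ n)) (\sum_(i < k) b i * a * c i)
    [seq lambda i | i <- index_enum 'I_k] beta.
Proof.
move=> mono b_sa c_sa hl hbeta.
pose phi m n : C := \sum_i kappa tau b c (nseq m true ++ nseq n.+1 false) (b i) (c i).
have Xf : \sum_(i < k) b i * a * c i = letter a b c false by [].
have Xt : star (\sum_(i < k) b i * a * c i) = letter a b c true.
  rewrite star_sum; apply: eq_bigr => i _ /=.
  by rewrite !starM b_sa c_sa a_sa mulrA.
have T0 : 0 <= k%:R * kappa_const tau b c by rewrite mulr_ge0// kappa_const_ge0.
exists (k%:R * (kappa_const tau b c * (k%:R * kappa_const tau b c))), phi; split.
- by rewrite mulr_ge0// mulr_ge0// kappa_const_ge0.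
- move=> n; rewrite Xf exprS -word_nseq (weight_letter_word mono)// size_nseq big_map.
  congr (_ * _); case: k b c lambda mono b_sa c_sa hl hbeta phi Xf Xt T0
    => [|k] b c lambda _ _ _ hl _ phi _ _ _.
    by rewrite !big_ord0.
  by rewrite -(mxtrace_pow_eigen _ hl) -kappa_trace.
- move=> m n; rewrite Xt Xf exprS -mulrA -!word_nseq.
  have -> : word a b c (nseq m true) * word a b c (nseq n.+1 false) =
    word a b c (nseq m true ++ nseq n.+1 false) by rewrite /word big_cat.
  rewrite (weight_letter_word mono); last by case: m.
  by rewrite size_cat !size_nseq addnS.
- move=> m q; rewrite big_map -hl /phi.
  case: k b c lambda mono b_sa c_sa hl hbeta phi Xf Xt T0
    => [|k] b c lambda _ _ _ hl _ phi _ _ _.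
    by move=> _; rewrite big1// => n _; rewrite big_ord0 mulr0.
  move=> hq; under eq_bigr do rewrite mulr_sumr.
  by rewrite exchange_big big1// => i _; apply: kappa_annihilated.
move=> m n; rewrite /phi; apply: le_trans (normc_sum _ _ _) _.
apply: (@le_trans _ _ (\sum_(i < k) kappa_const tau b c *
    ((k%:R * kappa_const tau b c) * beta ^+ (m + n)))).
  apply: ler_sum => i _.
  have h : normc (kappa tau b c (nseq m true ++ nseq n.+1 false) (b i) (c i)) <= _ :=
    kappa_bound tau b c (nseq m true ++ nseq n.+1 false) false true i i.
  apply: le_trans h _; rewrite size_cat !size_nseq addnS exprS ler_wpM2l ?kappa_const_ge0// ler_wpM2l//.
  by rewrite lerXn2r ?nnegrE// (le_trans T0).
rewrite sumr_const card_ord -mulr_natl.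
by rewrite le_eqVlt; apply/orP; left; apply/eqP; ring.
Qed.

Lemma scale_model (la : C) beta : weight_dom w a -> normc la <= beta ->
  moment_model (fun n => w (a ^+ n)) (la *: a) [:: la] beta.
Proof.
move=> aD hla; have aXD n : weight_dom w (a ^+ n.+1).
  elim: n => [//|n IH]; rewrite exprS; exact: weight_domM.
exists (normc la ^+ 2), (fun m n => Num.conj la ^+ m.+1 * la ^+ n.+1); split.
- by rewrite sqr_ge0.
- by move=> n; rewrite big_seq1 exprZn weightZ// mulrC.
- move=> m n; rewrite starZ a_sa !exprZn -scalerAl -scalerAr scalerA -exprD weightZ.
    by rewrite addSn addnS mulrC.
  by rewrite addSn; exact: aXD.
- move=> m q; rewrite big_seq1 dvdp_XsubCl rootE horner_coef => /eqP h.
  rewrite (eq_bigr (fun n : 'I__ => Num.conj la ^+ m.+1 * la * (q`_n * la ^+ n))).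
    by rewrite -mulr_sumr h mulr0.
  by move=> n _; rewrite [la ^+ n.+1]exprS; ring.
move=> m n; rewrite normcM !normcX normc_conj -exprD addSn addnS -addn2 addnC exprD.
by rewrite ler_wpM2l ?sqr_ge0// lerXn2r ?nnegrE ?normc_ge0// (le_trans _ hla)// normc_ge0.
Qed.

End Models.

(** * Realizations and eigenvalue multisets *)

Section Realizations.
Variables (R : realType) (A : starAlgType R) (w : tracial_weight A).
Local Notation C := R[i].

Lemma comp_big_split (T : Type) (f g : T -> T) p q u :
  (\big[(fun f g : T -> T => f \o g)/id]_(j < p + q) (if (j < p)%N then f else g)) u =
  iter p f (iter q g u).
Proof.
elim: p => [|p IH]; last by rewrite addSn big_ord_recl /= IH.
elim: q => [|q IHq]; first by rewrite big_ord0.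
by rewrite add0n big_ord_recl /=; congr g; rewrite -[RHS]IHq add0n.
Qed.

Lemma prod_split (f g : A) p q :
  \prod_(j < p + q) (if (j < p)%N then f else g) = f ^+ p * g ^+ q.
Proof.
elim: p => [|p IH]; last by rewrite addSn big_ord_recl /= IH exprS mulrA.
by rewrite add0n mul1r prodr_const card_ord.
Qed.

Lemma same_distr_split (Y : A) (H : hilbertType R) (x y : {linear H -> H}) :
  (forall (m : nat) (eps : 'I_m.+1 -> bool), has_trace
      (\big[(fun f g : H -> H => f \o g)/id]_(j < m.+1) (if eps j then y : H -> H else x))
      (w (\prod_(j < m.+1) (if eps j then star Y else Y)))) ->
  forall (s : bool) p q e, (0 < p + q)%N -> hilbert_basis e ->
  cplx_cvg (fun N => \sum_(i < N) hdot H
     (iter p (if s then y else x) (iter q (if s then x else y) (e i))) (e i))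
    (w ((if s then star Y else Y) ^+ p * (if s then Y else star Y) ^+ q)).
Proof.
move=> h s p q e pq he.
have := h (p + q).-1 (fun j => if (j < p)%N then s else ~~ s).
move: (prednK pq) => E; move: (p + q).-1 E => N E.
have e1 u : (\big[(fun f g : H -> H => f \o g)/id]_(j < N.+1)
    (if (if (j < p)%N then s else ~~ s) then y : H -> H else x)) u =
    iter p (if s then y else x) (iter q (if s then x else y) u).
  rewrite -comp_big_split E; congr (_ u); apply: eq_bigr => j _.
  by case: (j < p)%N; case: (s).
have e2 : \prod_(j < N.+1) (if (if (j < p)%N then s else ~~ s) then star Y else Y) =
    (if s then star Y else Y) ^+ p * (if s then Y else star Y) ^+ q.
  rewrite -prod_split E; apply: eq_bigr => j _.
  by case: (j < p)%N; case: (s).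
rewrite e2 => /has_trace_cplx_cvg/(_ he); apply: cplx_cvg_ext => n.
by apply: eq_bigr => i _; rewrite e1.
Qed.

Lemma operatorZ (H : hilbertType R) (f : {linear H -> H}) z u : f (z *: u) = z *: f u.
Proof. exact: linearZ. Qed.

Lemma adjoint_sym (H : hilbertType R) (x y : H -> H) : adjoint x y -> adjoint y x.
Proof. by move=> h u v; rewrite dotC -h -dotC. Qed.

Lemma realizes_moments (Y : A) (H : hilbertType R) (x : {linear H -> H}) : realizes w Y x ->
  exists y : {linear H -> H}, [/\ separable H /\ continuous x, adjoint x y,
    has_moments x (fun n => w (Y ^+ n)),
    has_star_moments x (fun m n => w (star Y ^+ m * Y ^+ n)) &
    has_star_moments y (fun m n => w (Y ^+ m * star Y ^+ n))].
Proof.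
move=> [sH [cx _] [y xy hw]]; exists y.
have hs := same_distr_split hw; have yx := adjoint_sym xy.
split=> //.
- move=> n n0 e he; have := hs true 0%N n e n0 he.
  by rewrite expr0 mul1r.
- move=> m n mn e he; have := hs true m n e mn he.
  by apply: cplx_cvg_ext => N; apply: eq_bigr => i _; rewrite -(iter_adjoint yx).
- move=> m n mn e he; have := hs false m n e mn he.
  by apply: cplx_cvg_ext => N; apply: eq_bigr => i _; rewrite -(iter_adjoint xy).
Qed.

(** The Hilbert-Schmidt norm of [T - adj T] is computed by the weight and
    vanishes. *)
Lemma realizes_selfadjoint (Y : A) (H : hilbertType R) (T : {linear H -> H}) :
  selfadjoint Y -> weight_dom w Y ->
  realizes w Y T -> adjoint T T.
Proof.
move=> Ysa YD hT; have [y [[sH cT] Ty hm1 hm2 hm2']] := realizes_moments hT.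
suff e u : T u = y u by move=> u v; rewrite Ty e.
apply/eqP; rewrite -subr_eq0.
have [->|u0] := eqVneq u 0; first by rewrite !linear0 ?subrr ?addr0 eqxx.
have [e he e0] := @basis_extension _ _ 1 (fun=> normalize u) sH
  ltac:(by move=> [|//] [|//] _ _; rewrite eqxx; apply/rnorm1_dot/rnorm_normalize).
have c1 := hm2 1%N 1%N isT e he; have c2 := hm2' 1%N 1%N isT e he.
have c3 : cplx_cvg (fun N => \sum_(i < N) hdot H (T (e i)) (y (e i))) (w (Y ^+ 2)).
  have := hm1 2 isT e he; apply: cplx_cvg_ext => N; apply: eq_bigr => i _.
  by rewrite /= Ty.
have c4 := cplx_cvg_conj c3.
have YYD : weight_dom w (Y ^+ 2) by rewrite expr2; exact: weight_domM.
have wr : Num.conj (w (Y ^+ 2)) = w (Y ^+ 2).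
  by rewrite -weight_star// expr2 starM Ysa.
have := cplx_cvgD (cplx_cvgD c1 c2) (cplx_cvgZ (-1) (cplx_cvgD c3 c4)).
rewrite wr Ysa !expr1 -expr2 mulN1r subrr => c5.
have := cplx_cvg_ge_partial (g := fun i => rnorm (T (e i) - y (e i)) ^+ 2) _ _ c5.
move=> /(_ (fun i => sqr_ge0 _)) h.
have {h} := h _ 1%N; rewrite big_ord1 e0//= => h.
have {h} h : rnorm (T (normalize u) - y (normalize u)) ^+ 2 <= 0.
  apply: h => N; rewrite rmorph_sum -!big_split mulr_sumr -!big_split [RHS]rmorph_sum.
  apply: eq_bigr => i _ /=.
  rewrite -dotxx dotDl !dotDr !dotNl !dotNr (dotC (y _) (T _)) opprK.
  by rewrite mulN1r opprD; ring.
have {h} h : T (normalize u) - y (normalize u) = 0.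
  by apply/eqP; rewrite -rnorm_eq0 -sqrf_eq0 eq_le h sqr_ge0.
move: (normalize u) (normalizeK u) h => v uv h.
by rewrite -uv (operatorZ T) (operatorZ y) -scalerBr h scaler0.
Qed.

Lemma mult_moment_model (a Y : A) (l : seq C) (b : R) (H : hilbertType R)
    (x : {linear H -> H}) (s : seq C) (d K : R) z :
  realizes w Y x -> moment_model w (fun n => w (a ^+ n)) Y l b ->
  0 < b -> all (fun u => normc u <= b) l ->
  0 < d -> 0 <= K -> all (fun u => u != 0) s ->
  (forall n, (1 < n)%N -> normc (w (a ^+ n) - \sum_(u <- s) u ^+ n) <= K * d ^+ n) ->
  z != 0 -> d * b * 2 <= normc z ->
  alg_mult x z (product_count s l z).
Proof.
move=> hx [B [phi [B0 h1 h2 h3 h4]]] b0 hl d0 K0 s0 hs z0 hz.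
have [y [[sH cx] xy hm1 hm2 hm2']] := realizes_moments hx.
apply: (alg_mult_moments sH cx xy hm1 hm2 hm2' (k := size l)) => r.
exact: (filter_polynomials b0 B0 h1 h2 h3 h4 hl d0 K0 s0 hs r z0 hz).
Qed.

Lemma trace_class_elt_spectral (a : A) (d : R) : selfadjoint a -> trace_class_elt w a ->
  0 < d -> exists (s : seq C) (K : R), [/\ all (fun u => u != 0) s, 0 <= K &
    forall n, (1 < n)%N -> normc (w (a ^+ n) - \sum_(u <- s) u ^+ n) <= K * d ^+ n].
Proof.
move=> asa [aD [H [T hT]]] d0; have TT := realizes_selfadjoint asa aD hT.
have [y [[sH cT] _ hm1 _ _]] := realizes_moments hT.
exact: spectral_moments sH cT TT hm1 d d0.
Qed.

(** The coordinates of the free family in the generating one form a matrix with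
    free rows. *)
Lemma has_dim_le (H : hilbertType R) (S : set H) n m : has_dim S n -> has_dim S m -> (n <= m)%N.
Proof.
move=> [e [Se he _]] [e' [_ _ he']].
have /choice[g hg] : forall i, exists f : 'I_m -> C, e i = \sum_j f j *: e' j.
  by move=> i; apply: he'.
pose M : 'M[C]_(n, m) := \matrix_(i, j) g i j.
have : row_free M.
  apply: inj_row_free => v hv; apply/rowP => i; rewrite mxE.
  apply: (he (fun i => v 0 i)).
  under eq_bigr do rewrite hg scaler_sumr.
  rewrite exchange_big big1// => j _ /=.
  under eq_bigr do rewrite scalerA.
  rewrite -scaler_suml; move: hv => /matrixP/(_ 0 j); rewrite !mxE => hv.
  rewrite (_ : \sum_(i0 < n) v 0 i0 * g i0 j = 0) ?scale0r// -[RHS]hv.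
  by apply: eq_bigr => i0 _; rewrite mxE.
by move=> /eqP <-; exact: rank_leq_col.
Qed.

Lemma has_dim_uniq (H : hilbertType R) (S : set H) n m : has_dim S n -> has_dim S m -> n = m.
Proof. by move=> h1 h2; apply/anti_leq; rewrite (has_dim_le h1 h2) (has_dim_le h2 h1). Qed.

(** [EV] is chosen by definite description; existence of a common multiplicity for
    all realizations, at every nonzero [z], is what makes the choice meaningful. *)
Lemma EV_mult (Y : A) : trace_class_elt w Y ->
  (forall z, z != 0 -> exists c, forall (H : hilbertType R) (x : {linear H -> H}),
     realizes w Y x -> alg_mult x z c) ->
  forall z c, z != 0 -> (forall (H : hilbertType R) (x : {linear H -> H}),
     realizes w Y x -> alg_mult x z c) -> EV w Y z = c.
Proof.
move=> tY h z c z0 hc; have [_ [H [x hx]]] := tY.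
have : is_EV w Y (EV w Y).
  have h' : forall u, exists c, u != 0 -> forall (H : hilbertType R) (x : {linear H -> H}),
     realizes w Y x -> alg_mult x u c.
    move=> u; have [u0|u0] := boolP (u != 0); last by exists 0%N.
    by have [c' hc'] := h u u0; exists c'.
  have [m hm] := choice h'.
  rewrite /EV; apply: (xgetPex (fun=> 0%N)).
  by exists m; split=> // H' x' hx' u u0; apply: hm.
by move=> [_ /(_ H x hx z z0) h1]; apply: has_dim_uniq h1 (hc H x hx).
Qed.

Lemma comp_big_scale (H : hilbertType R) (x y x' y' : {linear H -> H}) (la : C) n
    (eps : 'I_n -> bool) (u : H) :
  (forall v, x' v = la *: x v) -> (forall v, y' v = Num.conj la *: y v) ->
  (\big[(fun f g : H -> H => f \o g)/id]_(j < n) (if eps j then y' : H -> H else x')) u =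
  (\prod_(j < n) (if eps j then Num.conj la else la)) *:
  (\big[(fun f g : H -> H => f \o g)/id]_(j < n) (if eps j then y : H -> H else x)) u.
Proof.
move=> hx hy; elim: n eps => [|n IH] eps; first by rewrite !big_ord0 scale1r.
rewrite !big_ord_recl /= IH.
by case: (eps ord0); rewrite ?hx ?hy operatorZ scalerA.
Qed.

Lemma prod_scale (Y : A) (la : C) n (eps : 'I_n -> bool) :
  \prod_(j < n) (if eps j then star (la *: Y) else la *: Y) =
  (\prod_(j < n) (if eps j then Num.conj la else la)) *:
  \prod_(j < n) (if eps j then star Y else Y).
Proof.
elim: n eps => [|n IH] eps; first by rewrite !big_ord0 scale1r.
rewrite !big_ord_recl IH.
by case: (eps ord0); rewrite ?starZ -scalerAl -scalerAr scalerA.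
Qed.

Lemma weight_dom_prod (Y : A) n (eps : 'I_n.+1 -> bool) : weight_dom w Y ->
  weight_dom w (\prod_(j < n.+1) (if eps j then star Y else Y)).
Proof.
move=> YD; have h (b : bool) : weight_dom w (if b then star Y else Y).
  by case: b => //; exact: weight_dom_star.
elim: n eps => [|n IH] eps; first by rewrite big_ord1.
by rewrite big_ord_recl; apply: weight_domM.
Qed.

Lemma has_trace_scale (H : hilbertType R) (f g : H -> H) (z t : C) :
  (forall u, g u = z *: f u) -> has_trace f t -> has_trace g (z * t).
Proof.
move=> fg hf e he; apply/cplx_cvgP; have := cplx_cvgZ z (has_trace_cplx_cvg hf he).
apply: cplx_cvg_ext => n; rewrite /series /= big_mkord mulr_sumr.
by apply: eq_bigr => i _; rewrite fg dotZl.
Qed.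

Lemma scaled_operator (H : hilbertType R) (f : {linear H -> H}) (z : C) :
  exists2 g : {linear H -> H}, (forall u, g u = z *: f u) & (continuous f -> continuous g).
Proof.
have hl : linear (fun u : H => z *: f u).
  by move=> a u v; rewrite linearP scalerDr !scalerA mulrC.
pose L := GRing.isLinear.Build C H H *:%R (fun u : H => z *: f u) hl.
pose g : {linear H -> H} := HB.pack (fun u : H => z *: f u) L.
exists g => // cf u; apply: (continuous_comp (cf u)); exact: scaler_continuous.
Qed.

(** If [x] realizes [Y] then [la *: x] realizes [la *: Y], with absolute value
    [`|la| *: p]. *)
Lemma trace_class_elt_scale (Y : A) (la : C) :
  trace_class_elt w Y -> trace_class_elt w (la *: Y).
Proof.
move=> [YD [H [x [sH [cx [p [cp pp [y xy pxy]] [t pt]]] [y2 xy2 hw]]]]].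
split; first exact: weight_domZ.
have [x' hx' cx'] := scaled_operator x la.
have [y' hy' _] := scaled_operator y (Num.conj la).
have [y2' hy2' _] := scaled_operator y2 (Num.conj la).
have [p' hp' cp'] := scaled_operator p `|la|.
exists H, x'; split=> //.
  split; first exact: cx'.
  exists p'; last by exists (`|la| * t); apply: has_trace_scale pt.
  split; first exact: cp'.
    by move=> u; rewrite hp' dotZl mulr_ge0.
  exists y'; first by move=> u v; rewrite hx' hy' dotZl dotZr conjCK xy.
  move=> u /=; rewrite hp' hp' (operatorZ p) hy' hx' (operatorZ y) !scalerA.
  have := pxy u => /= ->; congr (_ *: _).
  by rewrite -expr2 normCK mulrC.
exists y2'; first by move=> u v; rewrite hx' hy2' dotZl dotZr conjCK xy2.
move=> m eps; rewrite prod_scale weightZ; last exact: weight_dom_prod.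
apply: has_trace_scale (hw m eps) => u; exact: comp_big_scale.
Qed.

End Realizations.

Theorem proposition13 (R : realType) (A : starAlgType R)
    (tau : {scalar A}) (w : tracial_weight A) (k : nat)
    (a : A) (b c : 'I_k -> A) (lambda : 'I_k -> R[i])
    (tau_state : tracial_state tau)
    (a_dom : weight_dom w a)
    (a_tc : trace_class_elt w a)
    (mono : cyclically_monotone w tau [set a] (range b `|` range c))
    (a_sa : selfadjoint a)
    (b_sa : forall i, selfadjoint (b i))
    (c_sa : forall i, selfadjoint (c i))
    (bac_tc : trace_class_elt w (\sum_(i < k) b i * a * c i))
    (lambda_eigen :
      char_poly (\matrix_(i < k, j < k) tau (c i * b j)) =
        \prod_(i < k) ('X - (lambda i)%:P)) :
  eq_multiset0 (EV w (\sum_(i < k) b i * a * c i))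
    (big_munion (fun i => EV w (lambda i *: a))).
Proof.
(* A single [beta] bounds the sum and all the [lambda i *: a], so that one list
   of eigenvalues of [a] serves to count all the multiplicities. *)
pose beta := k%:R * kappa_const tau b c + \sum_(i < k) normc (lambda i) + 1.
have K0 := kappa_const_ge0 tau b c.
have kK0 : 0 <= k%:R * kappa_const tau b c by rewrite mulr_ge0.
have L0 : 0 <= \sum_(i < k) normc (lambda i) by apply: sumr_ge0 => i _; exact: normc_ge0.
have beta0 : 0 < beta by rewrite ltr_wpDl// addr_ge0.
have lbeta i : normc (lambda i) <= beta.
  rewrite /beta (bigD1 i)//=.
  have : 0 <= \sum_(j < k | j != i) normc (lambda j) by apply: sumr_ge0 => j _; exact: normc_ge0.
  lra.
have model : moment_model w (fun n => w (a ^+ n)) (\sum_(i < k) b i * a * c i)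
    [seq lambda i | i <- index_enum 'I_k] beta.
  by apply: (letter_word_model a_sa mono) => //; rewrite /beta; lra.
have model1 i : moment_model w (fun n => w (a ^+ n)) (lambda i *: a) [:: lambda i] beta.
  exact: scale_model.
have lall : all (fun u => normc u <= beta) [seq lambda i | i <- index_enum 'I_k].
  by rewrite all_map; apply/allP => i _ /=.
have lall1 i : all (fun u => normc u <= beta) [:: lambda i] by rewrite /= lbeta.
have key z : z != 0 -> exists s : seq R[i],
  (forall (H : hilbertType R) (x : {linear H -> H}),
     realizes w (\sum_(i < k) b i * a * c i) x ->
     alg_mult x z (product_count s [seq lambda i | i <- index_enum 'I_k] z)) /\
  forall i (H : hilbertType R) (x : {linear H -> H}), realizes w (lambda i *: a) x ->
     alg_mult x z (product_count s [:: lambda i] z).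
  move=> z0; pose d := normc z / (2 * beta).
  have d0 : 0 < d by rewrite divr_gt0 ?mulr_gt0 ?normc_gt0.
  have hz : d * beta * 2 <= normc z.
    by rewrite /d -mulrA (mulrC beta) divfK// gt_eqF// mulr_gt0.
  have [s [K [s0 KK hs]]] := trace_class_elt_spectral a_sa a_tc d0.
  exists s; split=> [H x hx|i H x hx].
    exact: (mult_moment_model hx model beta0 lall d0 KK s0 hs z0 hz).
  exact: (mult_moment_model hx (model1 i) beta0 (lall1 i) d0 KK s0 hs z0 hz).
move=> z z0; have [s [h1 h2]] := key z z0.
rewrite /big_munion (EV_mult bac_tc _ z0 h1); last first.
  by move=> u u0; have [s' [h _]] := key u u0; 
  exists (product_count s' [seq lambda i | i <- index_enum 'I_k] u).
transitivity (\sum_(i < k) product_count s [:: lambda i] z)%N; last first.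
  apply: eq_bigr => i _; rewrite (EV_mult (trace_class_elt_scale (lambda i) a_tc) _ z0 (h2 i))//.
  by move=> u u0; have [s' [_ h]] := key u u0; exists (product_count s' [:: lambda i] u); exact: h.
rewrite /product_count; under [RHS]eq_bigr do under eq_bigr do rewrite big_seq1.
by rewrite [RHS]exchange_big /=; apply: eq_bigr => i _; rewrite big_map.
Qed.
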